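(* Let $P\subset\mathbb{R}^d$ be any full-dimensional convex polytope (not necessarily containing the origin). Then the intersection body $IP$ of $P$ is a semialgebraic subset of $\mathbb{R}^d$.
   Context: For a convex body (nonempty compact convex set) $K\subset\mathbb{R}^d$, its intersection body is defined via its radial function: for $x\in\mathbb{R}^d\setminus\{0\}$ set $\rho_{IK}(x)=\frac{1}{\|x\|}\operatorname{Vol}_{d-1}(K\cap x^\perp)$, where $x^\perp=\{y:\langle x,y\rangle=0\}$ and $\operatorname{Vol}_{d-1}$ is $(d-1)$-dimensional Euclidean volume, and $IK=\{x\in\mathbb{R}^d\setminus\{0\}:\rho_{IK}(x)\ge 1\}\cup\{0\}$. A set is semialgebraic if it is a finite Boolean combination of sets defined by polynomial inequalities with real coefficients. *)

(* Defs.v *)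
From HB Require Import structures.
From mathcomp Require Import all_boot all_order all_algebra.
From mathcomp Require Import all_classical all_reals all_analysis.
From mathcomp Require mpoly.
Set Implicit Arguments. Unset Strict Implicit. Unset Printing Implicit Defensive.
Import Order.TTheory GRing.Theory Num.Theory.
Local Open Scope classical_set_scope.
Local Open Scope ring_scope.

Section Defs.
Variable R : realType.

Definition dotv d (x y : 'rV[R]_d) : R := \sum_(i < d) x ord0 i * y ord0 i.
Definition enorm d (x : 'rV[R]_d) : R := Num.sqrt (dotv x x).

(* n-dimensional Lebesgue volume, defined by iterated (Tonelli) integration
   against the 1-dimensional Lebesgue measure. *)
Fixpoint vol (n : nat) : set 'rV[R]_n -> \bar R :=
  match n return set 'rV[R]_n -> \bar R with
  | 0 => fun A => if `[< A !=set0 >] then 1%E else 0%E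
  | n'.+1 => fun A =>
      (\int[@lebesgue_measure R]_(t in [set: R])
          vol [set v : 'rV[R]_n' | A (row_mx (\row_(j < 1) t) v)])%E
  end.

(* A (d-1) x d matrix whose rows form an orthonormal basis of x^perp
   (the map y |-> y *m M is a linear isometry R^(d-1) -> x^perp, onto when x != 0). *)
Definition perp_frame d (x : 'rV[R]_d) (M : 'M[R]_(d.-1, d)) : Prop :=
  M *m M^T = 1%:M /\ M *m x^T = 0.

(* Vol_{d-1}(K ∩ x^perp), computed through an (arbitrary, chosen) isometric
   parametrization of the hyperplane x^perp. *)
Definition section_vol d (K : set 'rV[R]_d) (x : 'rV[R]_d) : \bar R :=
  let M := xget 0 [set M | perp_frame x M] in
  vol [set y : 'rV[R]_(d.-1) | K (y *m M)].

Definition rho_I d (K : set 'rV[R]_d) (x : 'rV[R]_d) : \bar R :=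
  (section_vol K x * ((enorm x)^-1)%:E)%E.

Definition intersection_body d (K : set 'rV[R]_d) : set 'rV[R]_d :=
  [set x | x != 0 /\ (1 <= rho_I K x)%E] `|` [set 0].

Definition conv_hull d (V : seq 'rV[R]_d) : set 'rV[R]_d :=
  [set x | exists w : 'I_(size V) -> R,
     (forall i, 0 <= w i) /\ \sum_(i < size V) w i = 1 /\
     x = \sum_(i < size V) w i *: V`_i].

(* full-dimensional: nonempty interior in R^d (product topology on 'rV[R]_d,
   i.e. the usual Euclidean topology; R^o is only used to pick the topology) *)
Definition full_dimensional d (A : set 'rV[R]_d) : Prop :=
  (@interior _ (A : set 'rV[R^o]_d)) !=set0.

Definition coords d (x : 'rV[R]_d) : 'I_d -> R := fun i => x ord0 i.

Inductive semialgebraic d : set 'rV[R]_d -> Prop :=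
| sa_le (p : mpoly.mpoly d R) :
    semialgebraic [set x | 0 <= mpoly.meval (coords x) p]
| sa_lt (p : mpoly.mpoly d R) :
    semialgebraic [set x | 0 < mpoly.meval (coords x) p]
| sa_compl A : semialgebraic A -> semialgebraic (~` A)
| sa_union A B : semialgebraic A -> semialgebraic B -> semialgebraic (A `|` B)
| sa_inter A B : semialgebraic A -> semialgebraic B -> semialgebraic (A `&` B).

End Defs.

(* Main.v *)
(* The idea: fix a vector x and an orthonormal frame M of the hyperplane orthogonal
   to x, so that the section volume is the iterated integral of the indicator of
   {y | y M in P}.  By Fourier-Motzkin elimination P is a Boolean combination of
   affine half-spaces.  Integrating one variable of a piecewise polynomial function
   whose pieces are polyhedral gives a function of the same kind, since the
   breakpoints are affine in the other variables; the coefficients stay in the field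
   generated by the entries of M.  Taking for M the lower rows of a Householder
   reflection, these entries are rational in x and |x|, so the section volume is
   piecewise of the form (p + q |x|) / r with polynomials p, q, r and semialgebraic
   pieces.  The frame used in the definition is arbitrary, and any two frames of the
   same hyperplane differ by an orthogonal matrix; iterated integrals are invariant
   under these because an orthogonal matrix is a product of plane rotations, and a
   plane rotation is handled by two affine substitutions and Tonelli. *)
Require Import Defs.
From HB Require Import structures.
From mathcomp Require Import all_boot all_order all_algebra.
From mathcomp Require Import all_classical all_reals all_analysis.
From mathcomp Require Import measurable_realfun ring lra.
From mathcomp Require mpoly.
Import Order.TTheory GRing.Theory Num.Theory.
Import numFieldNormedType.Exports.
Set Implicit Arguments. Unset Strict Implicit. Unset Printing Implicit Defensive.
Local Open Scope classical_set_scope.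
Local Open Scope ring_scope.

(** * Polyhedral sets and piecewise polynomial functions *)

(** Kept relative to an abstract family [A], so that one theory serves for constant coefficients and
    for coefficients that depend on a parameter. The sets need not be convex: complements yield
    strict inequalities and unions. *)
Inductive polyhedral (R : realType) X (A : set (X -> R)) : set X -> Prop :=
| polyhedral_ge l : A l -> polyhedral A [set x | 0 <= l x]
| polyhedral_setC S : polyhedral A S -> polyhedral A (~` S)
| polyhedral_setI S T : polyhedral A S -> polyhedral A T -> polyhedral A (S `&` T).

(** Products with indicators stand for the pieces, so no explicit partition has to be carried
    along. *)
Inductive pwpoly (R : realType) X (A : set (X -> R)) : (X -> R) -> Prop :=
| pwpoly_base l : A l -> pwpoly A l
| pwpoly_add f g : pwpoly A f -> pwpoly A g -> pwpoly A (fun x => f x + g x)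
| pwpoly_mul f g : pwpoly A f -> pwpoly A g -> pwpoly A (fun x => f x * g x)
| pwpoly_indic S : polyhedral A S -> pwpoly A (fun x => `[< S x >]%:R).

(* [C] plays the role of the functions of the parameters alone, [A] of the functions
   that are affine in the variables with coefficients in [C]. *)
Record affine_class (R : realType) X (C A : set (X -> R)) : Prop := AffineClass {
  coef_cst : forall k, C (fun=> k);
  coef_add : forall a b, C a -> C b -> C (fun x => a x + b x);
  coef_mul : forall a b, C a -> C b -> C (fun x => a x * b x);
  coef_inv : forall a, C a -> C (fun x => (a x)^-1);
  aff_coef : C `<=` A;
  aff_add : forall l m, A l -> A m -> A (fun x => l x + m x);
  aff_scale : forall a l, C a -> A l -> A (fun x => a x * l x) }.

Section Dec.
Context {R : realType} {X : Type}.
Implicit Types (A C : set (X -> R)) (S T : set X).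

Lemma polyhedral_eq A S T : polyhedral A S -> (forall x, S x <-> T x) -> polyhedral A T.
Proof. by move=> dS ST; rewrite (_ : T = S)//; apply/seteqP; split=> x /ST. Qed.

Lemma polyhedral_setU A S T : polyhedral A S -> polyhedral A T -> polyhedral A (S `|` T).
Proof.
move=> dS dT; rewrite -[S `|` T]setCK setCU.
by apply/polyhedral_setC/polyhedral_setI; exact: polyhedral_setC.
Qed.

Lemma polyhedral_if A E S T : polyhedral A E -> polyhedral A S -> polyhedral A T ->
  polyhedral A (fun x => if `[< E x >] then S x else T x).
Proof.
move=> dE dS dT.
apply: (polyhedral_eq (S := (E `&` S) `|` (~` E `&` T))).
  by apply: polyhedral_setU; apply: polyhedral_setI => //; exact: polyhedral_setC.
move=> x; case: asboolP => Ex; split; rewrite /setI/setU/setC/=; tauto.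
Qed.

Lemma polyhedral_preimage Y A (B : set (Y -> R)) (phi : X -> Y) (S : set Y) :
  (forall l, B l -> A (l \o phi)) -> polyhedral B S -> polyhedral A (phi @^-1` S).
Proof.
move=> BA; elim=> {S} [l /BA Al|S _|S T _ dS _ dT].
- exact: (polyhedral_ge Al).
- exact: polyhedral_setC.
- exact: polyhedral_setI dS dT.
Qed.

Lemma pwpoly_eq A f g : pwpoly A f -> f =1 g -> pwpoly A g.
Proof. by move=> pf /funext <-. Qed.

Lemma pwpoly_if A E f g : polyhedral A E -> pwpoly A f -> pwpoly A g ->
  pwpoly A (fun x => if `[< E x >] then f x else g x).
Proof.
move=> dE pf pg.
apply: (pwpoly_eq (pwpoly_add (pwpoly_mul (pwpoly_indic dE) pf)
  (pwpoly_mul (pwpoly_indic (polyhedral_setC dE)) pg))).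
move=> x; have -> : `[< (~` E) x >] = ~~ `[< E x >] by exact: asbool_neg.
by case: asboolP => _ /=; rewrite !(mul1r, mul0r) ?(addr0, add0r).
Qed.

End Dec.

(** * Affine classes; sweeping over one distinguished variable *)

Section AffineClass.
Context {R : realType} {X : Type} {C A : set (X -> R)} (CA : affine_class C A).
Implicit Types (S T : set X).

Lemma aff_cst k : A (fun=> k).
Proof. exact/(aff_coef CA)/(coef_cst CA). Qed.

Lemma aff_opp l : A l -> A (fun x => - l x).
Proof.
move=> Al; have := aff_scale CA (coef_cst CA (-1)) Al.
by under eq_fun do rewrite mulN1r.
Qed.

Lemma aff_sub l m : A l -> A m -> A (fun x => l x - m x).
Proof. by move=> Al Am; exact: (aff_add CA Al (aff_opp Am)). Qed.

Lemma polyhedral_le l m : A l -> A m -> polyhedral A [set x | l x <= m x].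
Proof.
move=> Al Am; apply: (polyhedral_eq (polyhedral_ge (aff_sub Am Al))) => x /=.
by rewrite subr_ge0.
Qed.

Lemma polyhedral_eq0 l : A l -> polyhedral A [set x | l x = 0].
Proof.
move=> Al; apply: (polyhedral_eq (polyhedral_setI (polyhedral_ge Al)
  (polyhedral_ge (aff_opp Al)))) => x /=.
rewrite oppr_ge0; split=> [[]|->//] l0 l0'; apply/eqP; rewrite eq_le; exact/andP.
Qed.

Lemma polyhedral_setT : polyhedral A setT.
Proof. by apply: (polyhedral_eq (polyhedral_ge (aff_cst 0))) => x /=. Qed.

Lemma polyhedral_forall n (S : 'I_n -> set X) : (forall i, polyhedral A (S i)) ->
  polyhedral A [set x | forall i, S i x].
Proof.
elim: n S => [|n IH] S dS.
  by apply: (polyhedral_eq polyhedral_setT) => x; split=> // _ [].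
apply: (polyhedral_eq (polyhedral_setI (dS ord0) (IH _ (fun i => dS (lift ord0 i))))) => x.
split=> [[S0 Sl] i|Sx]; last by split.
by case: (unliftP ord0 i) => [j ->|->//]; exact: Sl.
Qed.

Lemma pwpoly_cst k : pwpoly A (fun=> k).
Proof. exact/pwpoly_base/aff_cst. Qed.

Lemma pwpoly_sum n (f : 'I_n -> X -> R) : (forall i, pwpoly A (f i)) ->
  pwpoly A (fun x => \sum_(i < n) f i x).
Proof.
elim: n f => [|n IH] f pf.
  by apply: (pwpoly_eq (pwpoly_cst 0)) => x; rewrite big_ord0.
apply: (pwpoly_eq (pwpoly_add (pf ord0) (IH _ (fun i => pf (lift ord0 i))))) => x.
by rewrite big_ord_recl.
Qed.

Lemma aff_sum n (f : 'I_n -> X -> R) : (forall i, A (f i)) ->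
  A (fun x => \sum_(i < n) f i x).
Proof.
elim: n f => [|n IH] f pf.
  by under eq_fun do rewrite big_ord0; exact: aff_cst.
under eq_fun do rewrite big_ord_recl.
exact: (aff_add CA (pf ord0) (IH _ (fun i => pf (lift ord0 i)))).
Qed.

Lemma pwpoly_exp f n : pwpoly A f -> pwpoly A (fun x => f x ^+ n).
Proof.
move=> pf; elim: n => [|n IH].
  by apply: (pwpoly_eq (pwpoly_cst 1)) => x; rewrite expr0.
by apply: (pwpoly_eq (pwpoly_mul pf IH)) => x; rewrite exprS.
Qed.

(* Piecewise functions of (x, t) whose pieces are cut out by conditions that
   are affine in the distinguished variable t. *)
Inductive tree V (L : set (X -> R -> V)) : (X -> R -> V) -> Prop :=
| leaf F : L F -> tree L F
| node a b F G : C a -> A b -> tree L F -> tree L G ->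
    tree L (fun x t => if 0 <= a x * t + b x then F x t else G x t).

Lemma tree_map V W (L : set (X -> R -> V)) (M : set (X -> R -> W)) (op : V -> W) F :
  (forall F, L F -> M (fun x t => op (F x t))) ->
  tree L F -> tree M (fun x t => op (F x t)).
Proof.
move=> LM; elim=> {F} [F /LM|a b F G Ca Ab _ IF _ IG]; first exact: leaf.
under eq_fun do under eq_fun do rewrite (fun_if op).
exact: node.
Qed.

(** The second tree is grafted onto every leaf of the first. *)
Lemma tree_map2 V1 V2 W (L1 : set (X -> R -> V1)) (L2 : set (X -> R -> V2))
    (M : set (X -> R -> W)) (op : V1 -> V2 -> W) F G :
  (forall F G, L1 F -> L2 G -> M (fun x t => op (F x t) (G x t))) ->
  tree L1 F -> tree L2 G -> tree M (fun x t => op (F x t) (G x t)).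
Proof.
move=> LM + tG; elim=> {F} [F LF|a b F F' Ca Ab _ IF _ IF'].
- elim: tG => {G} [G LG|a b G G' Ca Ab _ IG _ IG']; first exact/leaf/LM.
  under eq_fun do under eq_fun do rewrite (fun_if (op _)).
  exact: node.
- under eq_fun do under eq_fun do rewrite (fun_if (fun v => op v _)).
  exact: node.
Qed.

(* If [comb] glues the answers to a query on ]l, m[ and on ]m, u[, then the
   answer to the query on ]l x, u x[ is piecewise of the same kind in x: every
   node splits ]l x, u x[ at its affine breakpoint. *)
Lemma tree_sweep V W (L : set (X -> R -> V)) (K : set (X -> W)) (Kv : set (X -> V))
    (spec : R -> R -> (R -> V) -> W -> Prop) (comb : W -> W -> V -> W) F :
  (forall E f g, polyhedral A E -> K f -> K g ->
     K (fun x => if `[< E x >] then f x else g x)) ->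
  (forall f g v, K f -> K g -> Kv v -> K (fun x => comb (f x) (g x) (v x))) ->
  (forall l u h h' w, (forall t, l < t < u -> h t = h' t) ->
     spec l u h w -> spec l u h' w) ->
  (forall l m u h w w', l < m -> m < u -> spec l m h w -> spec m u h w' ->
     spec l u h (comb w w' (h m))) ->
  (forall F l, tree L F -> A l -> Kv (fun x => F x (l x))) ->
  (forall F l u, L F -> A l -> A u ->
     exists2 g, K g & forall x, l x < u x -> spec (l x) (u x) (F x) (g x)) ->
  tree L F -> forall l u, A l -> A u ->
  exists2 g, K g & forall x, l x < u x -> spec (l x) (u x) (F x) (g x).
Proof.
move=> K_if K_comb spec_local spec_cat K_subst K_leaf.
elim=> {F} [F /K_leaf//|a b F G Ca Ab tF IF tG IG l u Al Au].
(* The breakpoint in [t]. Where [a x = 0] this is the default value 0, and such [x] are treated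
   apart. *)
pose m x := - b x / a x.
have Am : A m.
  have := aff_scale CA (coef_inv CA Ca) (aff_opp Ab).
  by under eq_fun do rewrite mulrC.
have Aa := aff_coef CA Ca.
pose H x t := if 0 <= a x * t + b x then F x t else G x t.
(* The parameters are cut into regions [D] by the sign of [a] and the position of [m] relative to
   [l] and [u]; [split] glues the answers found on the regions. *)
pose realizable D := exists2 g, K g &
  forall x, D x -> l x < u x -> spec (l x) (u x) (H x) (g x).
suff [g Kg gP] : realizable setT by exists g => // x; exact: gP.
have split (E D : set X) : polyhedral A E ->
    realizable (D `&` E) -> realizable (D `&` ~` E) -> realizable D.
  move=> dE [f Kf fP] [g Kg gP].
  exists (fun x => if `[< E x >] then f x else g x); first exact: K_if.
  by move=> x Dx; case: asboolP => Ex; [exact: fP|exact: gP].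
have HF x t : 0 <= a x * t + b x -> H x t = F x t by rewrite /H => ->.
have HG x t : a x * t + b x < 0 -> H x t = G x t by rewrite /H ltNge => /negbTE ->.
have mP x t : a x != 0 -> a x * t + b x = a x * (t - m x).
  by move=> a0; rewrite /m; field.
have Kv_m := K_subst _ _ (node Ca Ab tF tG) Am.
have [Flu KFlu FluP] := IF _ _ Al Au.
have [Flm KFlm FlmP] := IF _ _ Al Am.
have [Fmu KFmu FmuP] := IF _ _ Am Au.
have [Glu KGlu GluP] := IG _ _ Al Au.
have [Glm KGlm GlmP] := IG _ _ Al Am.
have [Gmu KGmu GmuP] := IG _ _ Am Au.
have onF (D : set X) :
    (forall x t, D x -> l x < t < u x -> 0 <= a x * t + b x) -> realizable D.
  move=> DF; exists Flu => // x Dx lu; apply: spec_local (FluP x lu) => t lt.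
  by rewrite HF//; exact: DF.
have onG (D : set X) :
    (forall x t, D x -> l x < t < u x -> a x * t + b x < 0) -> realizable D.
  move=> DF; exists Glu => // x Dx lu; apply: spec_local (GluP x lu) => t lt.
  by rewrite HG//; exact: DF.
(* For [a = 0] the test does not involve [t]: the sign of [b] selects one branch on the whole
   interval. *)
apply: (split _ _ (polyhedral_eq0 Aa)).
  apply: (split _ _ (polyhedral_ge Ab)).
    by apply: onF => x t [[_ /= ->] /=]; rewrite mul0r add0r.
  by apply: onG => x t [[_ /= ->] /= /negP b0] _; rewrite mul0r add0r ltNge.
(* For [a > 0] the branch is [G] to the left of [m] and [F] to the right; if [m] is not inside the
   interval, only one of them remains. *)
apply: (split _ _ (polyhedral_ge Aa)).
  apply: (split _ _ (polyhedral_le Am Al)).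
    apply: onF => x t [[[_ /= /eqP a0] age0] ml] /andP[lt tu].
    by rewrite mP// mulr_ge0// subr_ge0 (le_trans ml)// ltW.
  apply: (split _ _ (polyhedral_le Au Am)).
    apply: onG => x t [[[[_ /= /eqP a0] age0] ml] um] /andP[lt tu].
    by rewrite mP// pmulr_rlt0 ?subr_lt0 ?(lt_le_trans tu)// lt0r a0.
  exists (fun x => comb (Glm x) (Fmu x) (H x (m x))).
    exact: (K_comb _ _ _ KGlm KFmu Kv_m).
  move=> x [[[[_ /= /eqP a0] age0] /negP+] /negP+] _; rewrite -!ltNge => lm mu.
  have a_gt0 : 0 < a x by rewrite lt0r a0.
  apply: spec_cat => //.
    apply: spec_local (GlmP x lm) => t /andP[_ tm].
    by rewrite HG// mP// pmulr_rlt0// subr_lt0.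
  apply: spec_local (FmuP x mu) => t /andP[mt _].
  by rewrite HF// mP// pmulr_rge0// subr_ge0 ltW.
(* For [a < 0] the two branches change sides. *)
apply: (split _ _ (polyhedral_le Am Al)).
  apply: onG => x t [[[_ /= /eqP a0] /negP+] ml] /andP[lt tu]; rewrite -ltNge => alt0.
  by rewrite mP// nmulr_rlt0// subr_gt0 (le_lt_trans ml).
apply: (split _ _ (polyhedral_le Au Am)).
  apply: onF => x t [[[[_ /= /eqP a0] /negP+] ml] um] /andP[lt tu].
  by rewrite -ltNge => alt0; rewrite mP// nmulr_rge0// subr_le0 (le_trans _ um)// ltW.
exists (fun x => comb (Flm x) (Gmu x) (H x (m x))).
  exact: (K_comb _ _ _ KFlm KGmu Kv_m).
move=> x [[[[_ /= /eqP a0] /negP+] /negP+] /negP+] _; rewrite -!ltNge => alt0 lm mu.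
apply: spec_cat => //.
  apply: spec_local (FlmP x lm) => t /andP[_ tm].
  by rewrite HF// mP// nmulr_rge0// subr_le0 ltW.
apply: spec_local (GmuP x mu) => t /andP[mt _].
by rewrite HG// mP// nmulr_rlt0// subr_gt0.
Qed.

Definition polyhedral_leaf : set (X -> R -> Prop) :=
  [set F | exists2 S, polyhedral A S & F = fun x _ => S x].

Lemma tree_polyhedral_subst F l : tree polyhedral_leaf F -> A l ->
  polyhedral A (fun x => F x (l x)).
Proof.
move=> + Al; elim=> {F} [F [S dS ->//]|a b F G Ca Ab _ IF _ IG].
have dE := polyhedral_ge (aff_add CA (aff_scale CA Ca Al) Ab).
by apply: (polyhedral_eq (polyhedral_if dE IF IG)) => x /=; rewrite asboolb.
Qed.

(** One-variable quantifier elimination through [tree_sweep]. Between breakpoints the leaf does not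
    depend on [t], so the midpoint serves as witness; [comb] includes the value at [m] because both
    open intervals omit it. *)
Lemma tree_exists F l u : tree polyhedral_leaf F -> A l -> A u ->
  (forall x, l x < u x) -> polyhedral A [set x | exists2 t, l x < t < u x & F x t].
Proof.
move=> tF Al Au lu.
pose spec (l u : R) (h : R -> Prop) (w : Prop) := (exists2 t, l < t < u & h t) <-> w.
pose comb w w' v : Prop := w \/ v \/ w'.
suff [g dg gP] : exists2 g : X -> Prop, polyhedral A g &
    forall x, l x < u x -> spec (l x) (u x) (F x) (g x).
  by apply: (polyhedral_eq dg) => x; split=> /(gP x (lu x)).
apply: (@tree_sweep _ _ polyhedral_leaf (polyhedral A) (polyhedral A) spec comb F
  _ _ _ _ _ _ tF l u Al Au).
- exact: polyhedral_if.
- by move=> f g v df dg dv; apply: polyhedral_setU => //; exact: polyhedral_setU.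
- move=> {l u Al Au lu}l u h h' w hh' [hw wh]; split=> [[t lt ht]|/wh[t lt ht]].
    by apply: hw; exists t => //; rewrite hh'.
  by exists t => //; rewrite -hh'.
- move=> {l u Al Au lu}l m u h w w' lm mu [hw wh] [hw' wh']; split.
    move=> [t /andP[lt tu] ht]; have [tm|mt|tm] := ltgtP t m.
    + by left; apply: hw; exists t; rewrite ?lt.
    + by right; right; apply: hw'; exists t; rewrite ?tu ?mt.
    + by right; left; rewrite -tm.
  move=> [/wh[t /andP[lt tm] ht]|[hm|/wh'[t /andP[lt tm] ht]]].
  + by exists t => //; rewrite lt (lt_trans tm).
  + by exists m; rewrite ?lm.
  + by exists t => //; rewrite tm (lt_trans lm).
- by move=> {tF}F {Al lu}l; exact: tree_polyhedral_subst.
- move=> {tF}_ {l u Al Au lu}l u [S dS ->] _ _; exists S => // x lu; split=> [[]//|Sx].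
  by exists ((l x + u x) / 2) => //; rewrite midf_lt// midf_lt.
Qed.

(** The degree bound [N] is uniform in [x]: it makes the integral of a leaf a sum with a fixed
    number of terms, hence again a member of [pwpoly A]. *)
Definition poly_leaf : set (X -> R -> R) :=
  [set F | exists p : X -> {poly R}, [/\ forall k, pwpoly A (fun x => (p x)`_k),
     exists N, forall x, (size (p x) <= N)%N & F = fun x t => (p x).[t]]].

Let mu := @lebesgue_measure R.

Lemma integral_horner (p : {poly R}) (N : nat) (l u : R) : (size p <= N)%N -> l < u ->
  (\int[mu]_(t in `]l, u[) (p.[t])%:E)%E =
  (\sum_(i < N) p`_i / i.+1%:R * (u ^+ i.+1 - l ^+ i.+1))%:E.
Proof.
move=> pN lu.
(* A primitive written with [N] terms whatever the size of [p]; the surplus coefficients are 0. *)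
pose P : {poly R} := \sum_(i < N) (p`_i / i.+1%:R) *: 'X^(i.+1).
have dP : P^`() = p.
  rewrite raddf_sum/= {2}(_ : p = \poly_(i < N) p`_i); last first.
    by apply/polyP => i; rewrite coef_poly; case: ltnP => // /(leq_trans pN) /leq_sizeP ->.
  rewrite poly_def; apply: eq_bigr => i _.
  by rewrite derivZ derivXn /= -[X in _ *: X]scaler_nat scalerA divfK// pnatr_eq0.
have mp (D : set R) : measurable_fun D (fun t => p.[t] : R).
  by apply: measurable_funTS; apply: continuous_measurable_fun; exact: continuous_horner.
rewrite -(@integral_itv_bndoo _ _ _ _ true false); last exact/measurable_EFinP.
rewrite (@continuous_FTC2 _ _ (horner P))//.
- rewrite -EFinB; congr EFin.
  rewrite /P !horner_sum -sumrB; apply: eq_bigr => i _.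
  by rewrite !hornerZ !hornerXn mulrBr.
- by apply: continuous_subspaceT; exact: continuous_horner.
- split.
  + by move=> x _; exact: derivable_horner.
  + by apply: cvg_at_right_filter; exact: continuous_horner.
  + by apply: cvg_at_left_filter; exact: continuous_horner.
- by move=> x _; rewrite -derivE dP.
Qed.

(** The instance of [tree_sweep] in which gluing is addition. [spec] also records measurability,
    which additivity of the integral requires; a breakpoint is a null set and contributes
    nothing. *)
Lemma tree_integral F l u : tree poly_leaf F -> A l -> A u ->
  (forall x, l x < u x) ->
  exists2 g, pwpoly A g & forall x, (\int[mu]_(t in `]l x, u x[) (F x t)%:E)%E = (g x)%:E.
Proof.
move=> tF Al Au lu.
pose spec (l u : R) (h : R -> R) (w : R) := measurable_fun `]l, u[ h /\
  (\int[mu]_(t in `]l, u[) (h t)%:E)%E = w%:E.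
pose comb (w w' _ : R) := w + w'.
suff [g dg gP] : exists2 g : X -> R, pwpoly A g &
    forall x, l x < u x -> spec (l x) (u x) (F x) (g x).
  by exists g => // x; have [_] := gP x (lu x).
apply: (@tree_sweep _ _ poly_leaf (pwpoly A) setT spec comb F _ _ _ _ _ _ tF l u Al Au).
- exact: pwpoly_if.
- by move=> f g v pf pg _; exact: pwpoly_add.
- move=> {l u Al Au lu}l u h h' w hh' [mh hw]; split.
    by apply: eq_measurable_fun mh => t; rewrite inE /= in_itv /=; exact: hh'.
  by rewrite -hw; apply: eq_integral => t; rewrite inE /= in_itv /= => /hh' ->.
- move=> {l u Al Au lu}l m u h w w' lm mu' [mh hw] [mh' hw'].
  have mh2 : measurable_fun (`]l, m] : set R) h by apply/measurable_fun_itv_bndo_bndcP.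
  have E : `]l, u[%classic = `]l, m] `|` `]m, u[ :> set R.
    by rewrite -itv_bndbnd_setU// bnd_simp ltW.
  split; first by rewrite E; apply/measurable_funU.
  rewrite E integral_setU//=.
  + rewrite -integral_itv_bndo_bndc ?hw ?hw'//; exact/measurable_EFinP.
  + by apply/measurable_EFinP/measurable_funU.
  + rewrite disj_set2E; apply/eqP; rewrite -subset0 => t [] /=.
    rewrite !in_itv /= => /andP[_ tm] /andP[mt _].
    by have := le_lt_trans tm mt; rewrite ltxx.
- by [].
- move=> {tF}_ {l u Al Au lu}l u [p [pk [N pN] ->]] Al Au.
  exists (fun x => \sum_(i < N) (p x)`_i / i.+1%:R * (u x ^+ i.+1 - l x ^+ i.+1)).
    apply: pwpoly_sum => i; apply: pwpoly_mul; first by apply: pwpoly_mul => //; exact: pwpoly_cst.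
    apply: pwpoly_add; first exact/pwpoly_exp/pwpoly_base.
    apply: (pwpoly_eq (pwpoly_mul (pwpoly_cst (-1)) (pwpoly_exp i.+1 (pwpoly_base Al)))) => x.
    by rewrite mulN1r.
  move=> x lu; split; last exact: integral_horner.
  by apply: measurable_funTS; apply: continuous_measurable_fun; exact: continuous_horner.
Qed.

End AffineClass.

Arguments tree {R X} C A {V} L _.
Arguments polyhedral_leaf {R X} A _.
Arguments poly_leaf {R X} A _.

(** * Elimination and integration of several variables *)

Definition lift_class (R : realType) X Y (C : set (X -> R)) : set (X * Y -> R) :=
  [set f | exists2 c, C c & f = fun p : X * Y => c p.1].

(** The slope in the new variable lies in [C] rather than in [A]: no product of two variables
    arises, and the breakpoint [- b / a] stays in [A]. *)
Definition ext1 (R : realType) X (C A : set (X -> R)) : set (X * R -> R) :=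
  [set f | exists a b, [/\ C a, A b & f = fun p : X * R => a p.1 * p.2 + b p.1]].

Definition extn (R : realType) X (C A : set (X -> R)) n : set (X * 'rV[R]_n -> R) :=
  [set f | exists a b, [/\ forall i, C (a i), A b &
     f = fun p : X * 'rV[R]_n => \sum_(i < n) a i p.1 * p.2 ord0 i + b p.1]].

Arguments extn {R X} C A n _.

Definition cons_rV (R : realType) n (t : R) (v : 'rV[R]_n) : 'rV[R]_n.+1 :=
  row_mx (\row_(j < 1) t) v.

Section ConsRV.
Context {R : realType} {n : nat}.
Implicit Types (t : R) (v : 'rV[R]_n).

Lemma cons_rV0 t v : cons_rV t v ord0 ord0 = t.
Proof.
rewrite /cons_rV (_ : ord0 = lshift n (ord0 : 'I_1)); last exact: val_inj.
by rewrite (@row_mxEl _ 1 1 n) mxE.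
Qed.

Lemma cons_rVS t v i : cons_rV t v ord0 (lift ord0 i) = v ord0 i.
Proof.
rewrite /cons_rV (_ : lift ord0 i = rshift 1 i); last exact: val_inj.
exact: (@row_mxEr _ 1 1 n).
Qed.

Lemma cons_rV_eta (v : 'rV[R]_n.+1) :
  v = cons_rV (v ord0 ord0) (\row_i v ord0 (lift ord0 i)).
Proof.
apply/rowP => i; case: (unliftP ord0 i) => [j ->|->].
  by rewrite cons_rVS mxE.
by rewrite cons_rV0.
Qed.

End ConsRV.

Section Extend.
Context {R : realType} {X : Type} {C A : set (X -> R)} (CA : affine_class C A).

(** This is what lets the inductions on the number of variables run: an adjoined variable becomes
    part of the parameter. *)
Lemma affine_class_ext1 : affine_class (lift_class (Y := R) C) (ext1 C A).
Proof.
split.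
- by move=> k; exists (fun=> k) => //; exact: (coef_cst CA).
- by move=> _ _ [a Ca ->] [b Cb ->]; exists (fun x => a x + b x) => //; exact: (coef_add CA).
- by move=> _ _ [a Ca ->] [b Cb ->]; exists (fun x => a x * b x) => //; exact: (coef_mul CA).
- by move=> _ [a Ca ->]; exists (fun x => (a x)^-1) => //; exact: (coef_inv CA).
- move=> _ [a Ca ->]; exists (fun=> 0), a; split; first exact: (coef_cst CA).
    exact: (aff_coef CA).
  by apply/funext => p; rewrite mul0r add0r.
- move=> _ _ [a [b [Ca Ab ->]]] [a' [b' [Ca' Ab' ->]]].
  exists (fun x => a x + a' x), (fun x => b x + b' x); split.
  + exact: (coef_add CA).
  + exact: (aff_add CA).
  + by apply/funext => p; rewrite mulrDl addrACA.
- move=> _ _ [c Cc ->] [a [b [Ca Ab ->]]].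
  exists (fun x => c x * a x), (fun x => c x * b x); split.
  + exact: (coef_mul CA).
  + exact: (aff_scale CA).
  + by apply/funext => p; rewrite mulrDr mulrA.
Qed.

Lemma polyhedral_tree S : polyhedral (ext1 C A) S ->
  tree C A (polyhedral_leaf A) (fun x t => S (x, t)).
Proof.
have leafP (P : Prop) : polyhedral A (fun=> P) ->
      tree C A (polyhedral_leaf A) (fun _ _ => P).
  by move=> dP; apply: leaf; exists (fun=> P).
elim=> {S} [l [a [b [Ca Ab ->]]]|S _ IS|S T _ IS _ IT].
- have -> : (fun x t => [set p | 0 <= a p.1 * p.2 + b p.1] (x, t)) =
      (fun x t => if 0 <= a x * t + b x then True else False).
    by apply/funext => x; apply/funext => t /=; rewrite propeqE; case: ifP.
  apply: node => //; apply: leafP; first exact: (polyhedral_setT CA).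
  by apply: (polyhedral_eq (polyhedral_setC (polyhedral_setT CA))) => x; split=> // /(_ I).
- apply: (tree_map (op := not) _ IS) => F [T dT ->].
  by exists (~` T) => //; exact: polyhedral_setC.
- apply: (tree_map2 (op := and) _ IS IT) => F G [S' dS ->] [T' dT ->].
  by exists (S' `&` T') => //; exact: polyhedral_setI.
Qed.

(** Under sums and products of trees the degree bounds of the leaves combine; an indicator puts
    constant polynomials on the tree of its set. *)
Lemma pwpoly_tree f : pwpoly (ext1 C A) f ->
  tree C A (poly_leaf A) (fun x t => f (x, t)).
Proof.
elim=> {f} [l [a [b [Ca Ab ->]]]|f g _ If _ Ig|f g _ If _ Ig|S dS].
- apply: leaf; exists (fun x => a x *: 'X + (b x)%:P); split.
  + move=> k; under eq_fun do rewrite coefD coefZ coefX coefC.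
    apply: pwpoly_add.
      by apply: pwpoly_mul; [exact/pwpoly_base/(aff_coef CA)|exact: (pwpoly_cst CA)].
    by case: (k == 0%N); [exact: pwpoly_base|exact: (pwpoly_cst CA)].
  + exists 2%N => x; rewrite (leq_trans (size_polyD _ _))// geq_max.
    by rewrite (leq_trans (size_scale_leq _ _)) ?size_polyX// (leq_trans (size_polyC_leq1 _)).
  + by apply/funext => x; apply/funext => t; rewrite hornerD hornerZ hornerX hornerC.
- apply: (tree_map2 (op := +%R) _ If Ig) => F G [p [pk [N pN] ->]] [q [qk [M qM] ->]].
  exists (fun x => p x + q x); split.
  + by move=> k; under eq_fun do rewrite coefD; exact: pwpoly_add.
  + exists (maxn N M) => x; rewrite (leq_trans (size_polyD _ _))// geq_max.
    by rewrite !leq_max pN qM orbT.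
  + by apply/funext => x; apply/funext => t; rewrite hornerD.
- apply: (tree_map2 (op := *%R) _ If Ig) => F G [p [pk [N pN] ->]] [q [qk [M qM] ->]].
  exists (fun x => p x * q x); split.
  + move=> k; under eq_fun do rewrite coefM.
    by apply: (pwpoly_sum CA) => i; exact: pwpoly_mul.
  + exists (N + M)%N => x; rewrite (leq_trans (size_polyMleq _ _))//.
    by rewrite (leq_trans (leq_pred _))// leq_add.
  + by apply/funext => x; apply/funext => t; rewrite hornerM.
- apply: (tree_map (op := fun P => `[< P >]%:R) _ (polyhedral_tree dS)) => F [T dT ->].
  exists (fun x => (`[< T x >]%:R)%:P); split.
  + move=> k; under eq_fun do rewrite coefC.
    by case: (k == 0%N); [exact: pwpoly_indic|exact: (pwpoly_cst CA)].
  + by exists 1%N => x; exact: size_polyC_leq1.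
  + by apply/funext => x; apply/funext => t; rewrite hornerC.
Qed.

Lemma extn0 l : extn C A 0 l -> A (fun x => l (x, 0)).
Proof.
move=> [a [b [_ Ab ->]]]; rewrite (_ : (fun _ => _) = b)//.
by apply/funext => x /=; rewrite big_ord0 add0r.
Qed.

Lemma extn_cons n (l : X * 'rV[R]_n.+1 -> R) : extn C A n.+1 l ->
  extn (lift_class (Y := R) C) (ext1 C A) n (fun p => l (p.1.1, cons_rV p.1.2 p.2)).
Proof.
move=> [a [b [Ca Ab ->]]].
exists (fun i p => a (lift ord0 i) p.1), (fun p => a ord0 p.1 * p.2 + b p.1); split.
- by move=> i; exists (a (lift ord0 i)).
- by exists (a ord0), b.
- apply/funext => -[[x t] v] /=; rewrite big_ord_recl cons_rV0 addrCA addrA.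
  by congr (_ + _ + _); apply: eq_bigr => i _; rewrite cons_rVS.
Qed.

End Extend.

(** Fourier-Motzkin elimination: once the first coordinate [t] is a parameter, the induction
    hypothesis removes the other coordinates, then [tree_exists] removes [t]. The bound [B] confines
    [t] to an interval with endpoints in [A]. *)
Lemma polyhedral_exists_rV (R : realType) (B : R) n : 0 < B ->
  forall X (C A : set (X -> R)), affine_class C A ->
  forall S : set (X * 'rV[R]_n), polyhedral (extn C A n) S ->
  (forall x v, S (x, v) -> forall i, - B < v ord0 i < B) ->
  polyhedral A [set x | exists v, S (x, v)].
Proof.
move=> B0; elim: n => [|n IH] X C A CA S dS SB.
  have dS0 : polyhedral A ((fun x => (x, 0)) @^-1` S).
    by apply: polyhedral_preimage dS => l; exact: extn0.
  apply: (polyhedral_eq dS0) => x; split=> [Sx|[v]]; first by exists 0.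
  by rewrite (thinmx0 v).
have CA1 := affine_class_ext1 CA.
pose S1 := (fun p : X * R * 'rV[R]_n => (p.1.1, cons_rV p.1.2 p.2)) @^-1` S.
have dS1 : polyhedral (extn (lift_class C) (ext1 C A) n) S1.
  by apply: polyhedral_preimage dS => l; exact: extn_cons.
have dS2 := IH _ _ _ CA1 _ dS1.
have S1B x v : S1 (x, v) -> forall i, - B < v ord0 i < B.
  by move=> /SB + i => /(_ (lift ord0 i)); rewrite cons_rVS.
have BB (x : X) : - B < B by rewrite gtrN.
apply: (polyhedral_eq (tree_exists CA (polyhedral_tree CA (dS2 S1B))
  (aff_cst CA _) (aff_cst CA _) BB)).
move=> x; split=> [[t _ [v Sv]]|[v Sv]]; first by exists (cons_rV t v).
  exists (v ord0 ord0); first exact: SB Sv _.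
  by exists (\row_i v ord0 (lift ord0 i)); move: Sv; rewrite {1}(cons_rV_eta v).
Qed.

Lemma vol_set0 (R : realType) n : vol (set0 : set 'rV[R]_n) = 0%E.
Proof.
elim: n => [|n IH] /=; first by case: asboolP => // -[].
by rewrite -[X in _ = X](integral0 (@lebesgue_measure R) setT); apply: eq_integral.
Qed.

(** Follows the recursion of [vol]: by induction the volume of a slice is piecewise polynomial in
    [(x, t)], and [tree_integral] integrates [t] out. *)
Lemma vol_pwpoly (R : realType) (B : R) n : 0 < B ->
  forall X (C A : set (X -> R)), affine_class C A ->
  forall S : set (X * 'rV[R]_n), polyhedral (extn C A n) S ->
  (forall x v, S (x, v) -> forall i, - B < v ord0 i < B) ->
  exists2 g, pwpoly A g & forall x, vol [set v | S (x, v)] = (g x)%:E.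
Proof.
move=> B0; elim: n => [|n IH] X C A CA S dS SB.
  have dS0 : polyhedral A ((fun x => (x, 0)) @^-1` S).
    by apply: polyhedral_preimage dS => l; exact: extn0.
  exists (fun x => `[< S (x, 0) >]%:R); first exact: pwpoly_indic dS0.
  move=> x /=; have -> : ([set v | S (x, v)] !=set0) = S (x, 0).
    rewrite propeqE; split=> [[v]|Sx]; last by exists 0.
    by rewrite (thinmx0 v).
  by case: asboolP.
have CA1 := affine_class_ext1 CA.
pose S1 := (fun p : X * R * 'rV[R]_n => (p.1.1, cons_rV p.1.2 p.2)) @^-1` S.
have dS1 : polyhedral (extn (lift_class C) (ext1 C A) n) S1.
  by apply: polyhedral_preimage dS => l; exact: extn_cons.
have S1B x v : S1 (x, v) -> forall i, - B < v ord0 i < B.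
  by move=> /SB + i => /(_ (lift ord0 i)); rewrite cons_rVS.
have [f pf fE] := IH _ _ _ CA1 _ dS1 S1B.
have [x|g pg gE] := tree_integral CA (pwpoly_tree CA pf) (aff_cst CA (- B)) (aff_cst CA B).
  by rewrite gtrN.
(* For [t] outside []-B, B[] the slice is empty, so the integral over the line reduces to this
   interval. *)
exists g => // x; rewrite -gE integral_mkcond /=.
apply: eq_integral => t _; rewrite patchE -fE.
case: ifPn => // /negP; rewrite inE /= in_itv /= => tB.
rewrite -[RHS](vol_set0 R n); congr vol.
apply/seteqP; split=> // v /= Sv; apply: tB.
by have := SB _ _ Sv ord0; rewrite cons_rV0.
Qed.

(** * Rotations of the plane *)

Section PlaneRotation.
Context {R : realType}.
Local Notation mu := (@lebesgue_measure R).
Local Notation T := (measurableTypeR R).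
Local Open Scope ereal_scope.

Lemma measurable_affine (a b : R) :
  measurable_fun setT (fun t : T => (a * t + b)%R : T).
Proof. by apply: measurable_funD => //; apply: measurable_funM. Qed.

(** Both sides are measures in [D]; by uniqueness of Lebesgue measure it is enough to compare them
    on half-open intervals. *)
Lemma lebesgue_measure_affine (a b : R) (D : set R) : a != 0%R -> measurable D ->
  mu D = `|a|%:E * mu ((fun t => (a * t + b)%R) @^-1` D).
Proof.
move=> a0 mD.
pose phi : T -> T := fun t => (a * t + b)%R.
have mphi : measurable_fun setT phi by exact: measurable_affine.
pose nu := mscale (NngNum (normr_ge0 a)) (pushforward mu phi).
suff : mu D = nu mphi D by [].
apply: lebesgue_measure_unique => // _ [[x y] /= _ <-].
rewrite /nu /mscale /= /pushforward lebesgue_measure_itv /= lte_fin.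
have [a_gt0|] := ltP 0%R a.
  have -> : phi @^-1` `]x, y] = `]((x - b) / a)%R, ((y - b) / a)%R]%classic.
    apply/seteqP; split=> t; rewrite /phi /= !in_itv /= ltr_pdivrMr// ler_pdivlMr//;
      by rewrite ltrBlDr lerBrDr mulrC.
  rewrite lebesgue_measure_itv /= lte_fin ltr_pM2r ?invr_gt0// ltrD2r.
  case: ifP => _; last by rewrite mule0.
  by rewrite -!EFinD -EFinM gtr0_norm//; congr EFin; field.
(* A negative slope exchanges the open and the closed end of the preimage. *)
rewrite le_eqVlt (negbTE a0) /= => a_lt0.
have -> : phi @^-1` `]x, y] = `[((y - b) / a)%R, ((x - b) / a)%R[%classic.
  apply/seteqP; split=> t; rewrite /phi /= !in_itv /= ltr_ndivlMr// ler_ndivrMr//;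
    by rewrite ltrBlDr lerBrDr (mulrC t) andbC.
rewrite lebesgue_measure_itv /= lte_fin ltr_nM2r ?invr_lt0// ltrD2r.
case: ifP => _; last by rewrite mule0.
by rewrite -!EFinD -EFinM ltr0_norm//; congr EFin; field.
Qed.

Lemma integral_affine (a b : R) (f : T -> \bar R) : a != 0%R ->
  measurable_fun setT f -> (forall t, 0 <= f t) ->
  \int[mu]_t f t = `|a|%:E * \int[mu]_t f (a * t + b)%R.
Proof.
move=> a0 mf f0.
pose phi : T -> T := fun t => (a * t + b)%R.
have mphi : measurable_fun setT phi by exact: measurable_affine.
pose nu := mscale (NngNum (normr_ge0 a)) (pushforward mu phi).
transitivity (\int[nu mphi]_t f t).
  apply: eq_measure_integral => D mD _.
  by rewrite [LHS](lebesgue_measure_affine b a0).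
by rewrite ge0_integral_mscale// ge0_integral_pushforward.
Qed.

(** For [d != 0] the change of variables is made one coordinate at a time: put [u = c s - d t] for
    [t] in the inner integral, exchange the integrals, then substitute for [s]. The factors [|d|^-1]
    and [|d|] cancel. *)
Lemma integral_rotation (c d : R) (h : T * T -> \bar R) : (c ^+ 2 + d ^+ 2 = 1)%R ->
  measurable_fun setT h -> (forall p, 0 <= h p) ->
  \int[mu]_s \int[mu]_t h (c * s - d * t, d * s + c * t)%R =
  \int[mu]_s \int[mu]_t h (s, t).
Proof.
move=> cd mh h0.
have hx x : measurable_fun setT (fun y => h (x, y)) by exact: measurableT_comp.
have hy y : measurable_fun setT (fun x => h (x, y)) by exact: measurableT_comp.
(* For [d = 0] there is no dividing by [d], but then [c] is 1 or -1 and each coordinate is merely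
   multiplied by [c]. *)
have [d0|d0] := eqVneq d 0%R.
  have c2 : (`|c| = 1)%R.
    by apply/eqP; rewrite -sqr_norm_eq1 -cd d0 expr0n addr0.
  have c0 : c != 0%R by rewrite -normr_eq0 c2 oner_eq0.
  transitivity (\int[mu]_s \int[mu]_t h (c * s + 0, t)%R).
    apply: eq_integral => s _.
    rewrite [RHS](@integral_affine c 0%R)// c2 mul1e.
    by apply: eq_integral => t _; rewrite d0 !mul0r subr0 !addr0 add0r.
  rewrite [RHS](@integral_affine c 0%R)// ?c2 ?mul1e//.
    exact: (measurable_fun_fubini_tonelli_F (m2 := mu) h mh h0).
  by move=> t; exact: integral_ge0.
(* [k (s, u)] is [h] at the rotated point: by [c ^+ 2 + d ^+ 2 = 1] the coordinate [d s + c t]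
   equals [(s - c u) / d]. *)
pose k (p : T * T) : \bar R := h (p.2, d^-1 * p.1 + - (c * p.2 / d))%R.
have mk : measurable_fun setT k.
  apply: (measurableT_comp mh); apply: measurable_fun_pair; first exact: measurable_snd.
  apply: measurable_funD; first by apply: measurable_funM => //; exact: measurable_fst.
  apply: measurableT_comp => //; apply: measurable_funM => //.
  by apply: measurable_funM => //; exact: measurable_snd.
have k0 p : 0 <= k p by exact: h0.
transitivity (\int[mu]_s (`|d|^-1%:E * \int[mu]_u k (s, u))).
  apply: eq_integral => s _.
  rewrite (@integral_affine (- d)%R (c * s)%R (fun u => k (s, u))) ?oppr_eq0//; last first.
    exact: (measurable_fun_pair2 _ mk).
  rewrite normrN muleA -EFinM mulVf ?normr_eq0// mul1e.
  apply: eq_integral => t _; rewrite /k /=; congr (h (_, _)).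
    by rewrite addrC mulNr.
  have -> : (d^-1 * s = d^-1 * s * (c ^+ 2 + d ^+ 2))%R by rewrite cd mulr1.
  by field.
rewrite ge0_integralZl//; last 2 first.
- exact: (measurable_fun_fubini_tonelli_F (m2 := mu) k mk k0).
- by move=> s _; apply: integral_ge0 => u _; exact: k0.
rewrite (fubini_tonelli k)//.
transitivity (`|d|^-1%:E * \int[mu]_u (`|d|%:E * \int[mu]_s h (u, s))).
  congr (_ * _); apply: eq_integral => u _.
  rewrite (@integral_affine d^-1 (- (c * u / d)))%R ?invr_eq0//.
  by rewrite muleA -EFinM normfV mulfV ?normr_eq0// mul1e.
rewrite ge0_integralZl//; last 2 first.
- exact: (measurable_fun_fubini_tonelli_F (m2 := mu) h mh h0).
- by move=> s _; exact: integral_ge0.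
by rewrite muleA -EFinM mulVf ?normr_eq0// mul1e.
Qed.

End PlaneRotation.

(** * Orthogonal matrices *)

Section Orthogonal.
Context {R : realType}.

Lemma dotv_mulmx d (x y : 'rV[R]_d) : x *m y^T = (dotv x y)%:M.
Proof.
apply/matrixP => i j; rewrite !ord1 !mxE eqxx mulr1n.
by apply: eq_bigr => k _; rewrite mxE.
Qed.

Lemma dotv_ge0 d (x : 'rV[R]_d) : 0 <= dotv x x.
Proof. by apply: sumr_ge0 => i _; rewrite -expr2 sqr_ge0. Qed.

Lemma dotv_eq0 d (x : 'rV[R]_d) : dotv x x = 0 -> x = 0.
Proof.
move=> /psumr_eq0P x0; apply/rowP => i; rewrite mxE; apply/eqP.
by rewrite -sqrf_eq0 expr2 x0// => j _; rewrite -expr2 sqr_ge0.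
Qed.

Lemma enorm_sqr d (x : 'rV[R]_d) : enorm x ^+ 2 = dotv x x.
Proof. by rewrite sqr_sqrtr// dotv_ge0. Qed.

Definition e0 n : 'rV[R]_n.+1 := delta_mx ord0 ord0.

(* If [v = 0] the junk value [2 / 0 = 0] makes this the identity. *)
Definition reflection n (v : 'rV[R]_n) : 'M[R]_n :=
  1%:M - (2 / dotv v v) *: (v^T *m v).

Lemma reflection_tr n (v : 'rV[R]_n) : (reflection v)^T = reflection v.
Proof.
apply/matrixP => i j; rewrite !mxE eq_sym; congr (_ - _ * _).
by rewrite !big_ord1 !mxE mulrC.
Qed.

Lemma reflection_orth n (v : 'rV[R]_n) : reflection v *m (reflection v)^T = 1%:M.
Proof.
rewrite reflection_tr.
rewrite /reflection mulmxBl mul1mx mulmxBr mulmx1 -scalemxAl -scalemxAr mulmxA -(mulmxA _ v).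
rewrite dotv_mulmx mul_mx_scalar -scalemxAl !scalerA.
have [->|v0] := eqVneq (dotv v v) 0; first by rewrite invr0 mulr0 !mul0r !scale0r !subr0.
by move: (v^T *m v) => X; apply/matrixP => i j; rewrite !mxE; field.
Qed.

Definition householder n (u : 'rV[R]_n.+1) : 'M[R]_n.+1 := reflection (u - enorm u *: e0 n).

(** Since [u] and [enorm u *: e0 n] have the same length, [dotv v v = 2 * dotv u v], so the
    reflection subtracts exactly [v] from [u]. If [v = 0] then [u] is already its own image. *)
Lemma householder_mul n (u : 'rV[R]_n.+1) : u *m householder u = enorm u *: e0 n.
Proof.
rewrite /householder; set v := u - _.
have dv : dotv v v = 2 * dotv u v.
  have E : dotv u u = enorm u ^+ 2 by rewrite enorm_sqr.
  have vv : v *m v^T = 2 *: (u *m v^T).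
    have -> : v^T = u^T - enorm u *: (e0 n)^T by apply/matrixP => i j; rewrite !mxE.
    rewrite /v !mulmxBl !mulmxBr -!scalemxAl -!scalemxAr.
    have ee : e0 n *m (e0 n)^T = 1%:M.
      by rewrite trmx_delta mul_delta_mx; apply/matrixP => i j; rewrite !ord1 !mxE.
    have eu : e0 n *m u^T = u *m (e0 n)^T.
      by rewrite -[LHS]trmxK trmx_mul trmxK; apply/matrixP => i j; rewrite !ord1 mxE.
    rewrite ee eu; set w := u *m (e0 n)^T; rewrite (dotv_mulmx u u) E.
    apply/matrixP => i j; rewrite !ord1 !mxE /=; ring.
  by move: vv; rewrite !dotv_mulmx => /matrixP/(_ 0 0); rewrite !mxE /= !mulr1n.
rewrite /reflection mulmxBr mulmx1 -scalemxAr mulmxA dotv_mulmx mul_scalar_mx scalerA.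
have [v0|v0] := eqVneq (dotv v v) 0.
  rewrite v0 invr0 mulr0 mul0r scale0r subr0.
  by move/dotv_eq0: v0 => /eqP; rewrite subr_eq0 => /eqP.
have -> : 2 / dotv v v * dotv u v = 1.
  by move: v0; rewrite dv mulf_eq0 negb_or => /andP[_ uv]; field.
by rewrite scale1r /v opprB addrC subrK.
Qed.

(** [y] is recovered as [y *m M *m M^T], and the entries of [M] are at most 1 in absolute value
    because its rows are unit vectors. The added 1 keeps the bound strict. *)
Lemma orth_bound n d (M : 'M[R]_(n, d)) (B : R) (y : 'rV[R]_n) : M *m M^T = 1%:M ->
  (forall j, - B < (y *m M) ord0 j < B) ->
  forall i, - (d%:R * B + 1) < y ord0 i < d%:R * B + 1.
Proof.
move=> MM yB i; rewrite -ltr_norml.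
have M1 j : `|M i j| <= 1.
  have : (M *m M^T) i i = 1 by rewrite MM mxE eqxx.
  rewrite mxE (bigD1 j)//= mxE -expr2 => E.
  rewrite -(@ler_pXn2r _ 2) ?nnegrE// expr1n real_normK ?num_real// -E lerDl.
  by apply: sumr_ge0 => k _; rewrite mxE -expr2 sqr_ge0.
have -> : y = y *m M *m M^T by rewrite -mulmxA MM mulmx1.
rewrite mxE; apply: le_lt_trans (ler_norm_sum _ _ _) _.
apply: (@le_lt_trans _ _ (\sum_(j < d) B)); last first.
  by rewrite sumr_const card_ord -[B *+ d]mulr_natl ltrDl.
apply: ler_sum => j _; rewrite normrM [M^T _ _]mxE -[leRHS]mulr1.
by apply: ler_pM => //; rewrite ltW// ltr_norml.
Qed.

Definition diag1 n (Q : 'M[R]_n) : 'M[R]_n.+1 := block_mx (1%:M : 'M[R]_1) 0 0 Q.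

Definition givens n (c d : R) : 'M[R]_n.+2 :=
  block_mx (c%:M : 'M[R]_1) (row_mx (d%:M : 'M[R]_1) 0)
    (col_mx ((- d)%:M : 'M[R]_1) 0) (block_mx (c%:M : 'M[R]_1) 0 0 1%:M).

Lemma mul_cons_diag1 n t (v : 'rV[R]_n) Q : cons_rV t v *m diag1 Q = cons_rV t (v *m Q).
Proof.
rewrite /cons_rV /diag1 (@mul_row_block _ 1 1 n 1 n).
by rewrite !mulmx0 mulmx1 addr0 add0r.
Qed.

Lemma mul_cons_givens n s t (v : 'rV[R]_n) c d :
  cons_rV s (cons_rV t v) *m givens n c d =
  cons_rV (c * s - d * t) (cons_rV (d * s + c * t) v).
Proof.
rewrite /cons_rV /givens (@mul_row_block _ 1 1 n.+1 1 n.+1).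
rewrite (@mul_row_col _ 1 1 n) (@mul_mx_row _ 1 1 1 n) (@mul_row_block _ 1 1 n 1 n).
rewrite (@add_row_mx _ 1 1 n) !mulmx0 mulmx1 !addr0 !add0r !mul_mx_scalar.
have E a b x y : a *: (\row_(_ < 1) x) + b *: (\row_(_ < 1) y) =
    \row_(_ < 1) (a * x + b * y) :> 'rV[R]_1 by apply/rowP => i; rewrite !mxE.
by rewrite !E mulNr.
Qed.

Lemma givens_orth n c d : c ^+ 2 + d ^+ 2 = 1 -> givens n c d *m (givens n c d)^T = 1%:M.
Proof.
move=> cd.
have -> : (givens n c d)^T = givens n c (- d).
  rewrite /givens (@tr_block_mx _ 1 n.+1 1 n.+1) (@tr_row_mx _ 1 1 n).
  rewrite (@tr_col_mx _ 1 n 1) (@tr_block_mx _ 1 n 1 n).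
  by rewrite !tr_scalar_mx !trmx0 opprK.
have GG (v : 'rV[R]_n.+2) : v *m givens n c d *m givens n c (- d) = v.
  rewrite (cons_rV_eta v); move: (v _ _) (\row__ _) => s u.
  rewrite (cons_rV_eta u); move: (u _ _) (\row__ _) => t w.
  rewrite !mul_cons_givens; congr cons_rV; [|congr cons_rV];
    by rewrite -[RHS]mul1r -cd; ring.
by apply/row_matrixP => i; rewrite row_mul -[givens n c d]mul1mx row_mul GG.
Qed.

Lemma diag1_tr n (Q : 'M[R]_n) : (diag1 Q)^T = diag1 Q^T.
Proof. by rewrite /diag1 (@tr_block_mx _ 1 n 1 n) trmx1 !trmx0. Qed.

Lemma diag1_mul n (P Q : 'M[R]_n) : diag1 P *m diag1 Q = diag1 (P *m Q).
Proof.
rewrite /diag1 (@mulmx_block _ 1 n 1 n 1 n).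
by rewrite !(mulmx0, mul0mx, mulmx1) addr0 !add0r.
Qed.

Lemma diag1_1 n : diag1 (1%:M : 'M[R]_n) = 1%:M.
Proof. by rewrite /diag1 -(@scalar_mx_block _ 1 n 1). Qed.

Lemma diag1_inj n : injective (@diag1 n).
Proof. by move=> P Q E; have [] := @eq_block_mx _ 1 n 1 n _ _ _ _ _ _ _ _ E. Qed.

(** If [W] fixes [e0], so does its inverse [W^T]; hence the first row and the first column of [W]
    are those of the identity. *)
Lemma row0_diag1 n (W : 'M[R]_n.+1) : W *m W^T = 1%:M -> e0 n *m W = e0 n ->
  exists2 Q, Q *m Q^T = 1%:M & W = diag1 Q.
Proof.
move=> WW We.
have We' : e0 n *m W^T = e0 n by rewrite -[in LHS]We -mulmxA WW mulmx1.
have EW : W = diag1 (@drsubmx _ 1 n 1 n W).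
  have W0 (i : 'I_n.+1) : W ord0 i = (i == ord0)%:R.
    by move/rowP: We => /(_ i); rewrite -rowE !mxE.
  have W0' (i : 'I_n.+1) : W i ord0 = (i == ord0)%:R.
    by move/rowP: We' => /(_ i); rewrite -rowE !mxE.
  have l0 : lshift n (ord0 : 'I_1) = ord0 by exact: val_inj.
  rewrite -[LHS](@submxK _ 1 n 1 n W) /diag1.
  have -> : @ulsubmx _ 1 n 1 n W = 1%:M.
    by apply/matrixP => i j; rewrite !ord1 !mxE l0 W0.
  have -> : @ursubmx _ 1 n 1 n W = 0.
    by apply/matrixP => i j; rewrite !ord1 !mxE l0 W0.
  have -> // : @dlsubmx _ 1 n 1 n W = 0.
  by apply/matrixP => i j; rewrite !ord1 !mxE l0 W0'.
exists (@drsubmx _ 1 n 1 n W) => //.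
by apply: diag1_inj; rewrite -diag1_mul -diag1_tr -EW WW diag1_1.
Qed.

(** Let [(c, u)] be the first row of [O]. The Householder matrix [H] of [u] turns it into
    [(c, d, 0)] with [d = enorm u], which is the first row of the rotation [G]. Thus
    [O *m diag1 H *m G^T] fixes [e0] and has the form [diag1 P]. *)
Lemma orth_decomp n (O : 'M[R]_n.+2) : O *m O^T = 1%:M ->
  exists P Q : 'M[R]_n.+1, exists c d,
    [/\ P *m P^T = 1%:M, Q *m Q^T = 1%:M, c ^+ 2 + d ^+ 2 = 1 &
        O = diag1 P *m givens n c d *m diag1 Q].
Proof.
move=> OO.
have := cons_rV_eta (e0 n.+1 *m O); set c := _ ord0 ord0; set u := (X in cons_rV c X) => uE.
pose H := householder u; pose d := enorm u.
have HH : H *m H^T = 1%:M by exact: reflection_orth.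
have Ee (x : R) m : x *: e0 m = cons_rV x 0.
  apply/rowP => i; case: (unliftP ord0 i) => [j ->|->].
    by rewrite cons_rVS !mxE mulr0.
  by rewrite cons_rV0 !mxE mulr1.
have uH : e0 n.+1 *m O *m diag1 H = cons_rV c (cons_rV d 0).
  by rewrite uE mul_cons_diag1 householder_mul Ee.
have E1 : (e0 n.+1 *m O *m diag1 H) *m (e0 n.+1 *m O *m diag1 H)^T = 1%:M.
  rewrite !trmx_mul !mulmxA -(mulmxA _ (diag1 H)) diag1_tr diag1_mul HH diag1_1 mulmx1.
  rewrite -(mulmxA _ O) OO mulmx1 trmx_delta mul_delta_mx.
  by apply/matrixP => i j; rewrite !ord1 !mxE.
have cd : c ^+ 2 + d ^+ 2 = 1.
  move: E1; rewrite uH dotv_mulmx => /matrixP/(_ 0 0); rewrite !mxE /= !mulr1n => <-.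
  rewrite /dotv big_ord_recl cons_rV0 big_ord_recl cons_rVS cons_rV0.
  by rewrite big1 ?addr0// => i _; rewrite !cons_rVS mxE mulr0.
have GG := givens_orth n cd.
pose G := givens n c d.
have [P PP PE] : exists2 P, P *m P^T = 1%:M & O *m diag1 H *m G^T = diag1 P.
  apply: row0_diag1.
    rewrite !trmx_mul trmxK !mulmxA -(mulmxA _ G^T) (mulmx1C GG) mulmx1.
    by rewrite -(mulmxA _ (diag1 H)) diag1_tr diag1_mul HH diag1_1 mulmx1.
  rewrite !mulmxA uH (_ : cons_rV c _ = e0 n.+1 *m G) -?mulmxA ?GG ?mulmx1//.
  rewrite -[e0 _]scale1r Ee (_ : (0 : 'rV_n.+1) = cons_rV 0 0) ?mul_cons_givens.
    by rewrite !mulr1 !mulr0 subr0 addr0.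
  by rewrite -Ee scale0r.
exists P, H^T, c, d; split => //; first by rewrite trmxK; exact: mulmx1C HH.
rewrite -PE -!mulmxA (mulmxA G^T) (mulmx1C GG) mul1mx diag1_mul HH diag1_1.
by rewrite mulmx1.
Qed.

End Orthogonal.

(** * Orthogonal invariance of the volume *)

Section Measurable.
Context {R : realType}.

Lemma polyhedral_measurable d (Y : measurableType d) (A : set (Y -> R)) S :
  (forall l, A l -> measurable_fun setT l) -> polyhedral A S -> measurable S.
Proof.
move=> mA; elim=> {S} [l /mA ml|S _|S T _ mS _ mT].
- rewrite -[X in measurable X]setTI.
  by have := ml measurableT _ (measurable_itv `[0, +oo[); congr measurable;
    apply/seteqP; split=> x /=; rewrite in_itv /= andbT.
- exact: measurableC.
- exact: measurableI.
Qed.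

Lemma pwpoly_measurable d (Y : measurableType d) (A : set (Y -> R)) f :
  (forall l, A l -> measurable_fun setT l) -> pwpoly A f -> measurable_fun setT f.
Proof.
move=> mA; elim=> {f} [l /mA//|f g _ mf _ mg|f g _ mf _ mg|S /(polyhedral_measurable mA) mS].
- exact: measurable_funD.
- exact: measurable_funM.
- rewrite (_ : (fun _ => _) = \1_S); first exact: measurable_indic.
  by apply/funext => x; rewrite indicE.
Qed.

End Measurable.

Section Invariance.
Context {R : realType}.
Local Notation mu := (@lebesgue_measure R).
Local Notation T := (measurableTypeR R).

Definition affv n : set ('rV[R]_n -> R) :=
  [set l | exists a b, l = fun v : 'rV[R]_n => \sum_(i < n) a i * v ord0 i + b].

Lemma affv_mul n m (M : 'M[R]_(n, m)) l : affv l -> affv (fun v => l (v *m M)).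
Proof.
move=> [a [b ->]]; exists (fun i => \sum_(j < m) a j * M i j), b.
apply/funext => v; congr (_ + b).
under eq_bigr do rewrite mxE mulr_sumr.
rewrite exchange_big; apply: eq_bigr => i _; rewrite mulr_suml.
by apply: eq_bigr => j _; rewrite -mulrA (mulrC (M i j)).
Qed.

Lemma affv_cons n t l : affv l -> affv (fun v : 'rV[R]_n => l (cons_rV t v)).
Proof.
move=> [a [b ->]]; exists (fun i => a (lift ord0 i)), (a ord0 * t + b).
apply/funext => v; rewrite big_ord_recl cons_rV0 addrCA addrA.
by congr (_ + _ + _); apply: eq_bigr => i _; rewrite cons_rVS.
Qed.

Definition bounded_by n (B : R) (S : set 'rV[R]_n) :=
  forall v, S v -> forall i, - B < v ord0 i < B.

(** A one-point parameter space gives the case without parameters, where the coefficients are real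
    numbers. *)
Lemma affine_class_unit : affine_class (setT : set (unit -> R)) setT.
Proof. by []. Qed.

Lemma polyhedral_affv_unit n (S : set 'rV[R]_n) : polyhedral (@affv n) S ->
  polyhedral (extn (setT : set (unit -> R)) setT n) [set p | S p.2].
Proof.
apply: polyhedral_preimage => _ [a [b ->]].
by exists (fun i _ => a i), (fun=> b).
Qed.

Lemma ext1_measurable d (Y : measurableType d) (C A : set (Y -> R)) :
  (forall l, C l -> measurable_fun setT l) -> (forall l, A l -> measurable_fun setT l) ->
  forall l : Y * T -> R, ext1 C A l -> measurable_fun setT l.
Proof.
move=> mC mA _ [a [b [/mC ma /mA mb ->]]].
apply: measurable_funD; last by apply: measurableT_comp => //; exact: measurable_fst.
apply: measurable_funM; last exact: measurable_snd.
by apply: measurableT_comp => //; exact: measurable_fst.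
Qed.

Lemma lift_measurable d d' (Y : measurableType d) (Z : measurableType d') (C : set (Y -> R)) :
  (forall l, C l -> measurable_fun setT l) ->
  forall l : Y * Z -> R, lift_class C l -> measurable_fun setT l.
Proof.
move=> mC _ [a /mC ma ->].
by apply: measurableT_comp => //; exact: measurable_fst.
Qed.

Lemma unit_measurable (l : unit -> R) : (setT : set (unit -> R)) l -> measurable_fun setT l.
Proof.
move=> _; rewrite (_ : l = cst (l tt)); first exact: measurable_cst.
by apply/funext => -[].
Qed.

(** By [vol_pwpoly] with [t] as parameter the slice volume is piecewise polynomial, hence
    measurable, as the substitution in [integral_affine] requires. *)
Lemma vol_measurable1 n B (S : set 'rV[R]_n.+1) : 0 < B -> polyhedral (@affv n.+1) S ->
  bounded_by B S -> measurable_fun setT (fun t : T => vol [set v | S (cons_rV t v)]).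
Proof.
move=> B0 dS SB.
have CA := affine_class_ext1 affine_class_unit.
have dS1 : polyhedral (extn (lift_class setT) (ext1 setT setT) n)
    [set p : unit * R * 'rV[R]_n | S (cons_rV p.1.2 p.2)].
  apply: (polyhedral_preimage (phi := fun p => (p.1.1, cons_rV p.1.2 p.2)))
    (polyhedral_affv_unit dS).
  by move=> l; exact: extn_cons.
have [|g pg gE] := vol_pwpoly B0 CA dS1.
  by move=> x v /= /SB + i => /(_ (lift ord0 i)); rewrite cons_rVS.
have mg : measurable_fun setT (g : unit * T -> R).
  by apply: pwpoly_measurable pg; apply: ext1_measurable => l; exact: unit_measurable.
rewrite (_ : (fun _ => _) = EFin \o (g \o pair tt)).
  by apply/measurable_EFinP; apply: measurableT_comp.
by apply/funext => t; rewrite /= -gE.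
Qed.

(** Joint measurability in the first two coordinates, needed for Tonelli in the plane rotation. *)
Lemma vol_measurable2 n B (S : set 'rV[R]_n.+2) : 0 < B -> polyhedral (@affv n.+2) S ->
  bounded_by B S ->
  measurable_fun setT (fun p : T * T => vol [set v | S (cons_rV p.1 (cons_rV p.2 v))]).
Proof.
move=> B0 dS SB.
have CA := affine_class_ext1 (affine_class_ext1 affine_class_unit).
have dS2 : polyhedral (extn (lift_class (lift_class setT))
    (ext1 (lift_class setT) (ext1 setT setT)) n)
    [set p : unit * R * R * 'rV[R]_n | S (cons_rV p.1.1.2 (cons_rV p.1.2 p.2))].
  apply: (polyhedral_preimage (phi := fun p => (p.1.1.1, cons_rV p.1.1.2 (cons_rV p.1.2 p.2))))
    (polyhedral_affv_unit dS).
  by move=> l /extn_cons; exact: extn_cons.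
have [|g pg gE] := vol_pwpoly B0 CA dS2.
  by move=> x v /= /SB + i => /(_ (lift ord0 (lift ord0 i))); rewrite !cons_rVS.
have mg : measurable_fun setT (g : unit * T * T -> R).
  apply: pwpoly_measurable pg; apply: ext1_measurable.
    by apply: lift_measurable => l; exact: unit_measurable.
  by apply: ext1_measurable => l; exact: unit_measurable.
rewrite (_ : (fun _ => _) = EFin \o (g \o (fun p : T * T => (tt, p.1, p.2)))).
  apply/measurable_EFinP; apply: measurableT_comp => //.
  apply: measurable_fun_pair; last exact: measurable_snd.
  by apply: measurable_fun_pair; [exact: measurable_cst|exact: measurable_fst].
by apply/funext => t; rewrite /= -gE.
Qed.

Lemma vol_ge0 n (S : set 'rV[R]_n) : (0 <= vol S)%E.
Proof.
elim: n S => [|n IH] S /=; first by case: asboolP.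
by apply: integral_ge0 => t _; exact: IH.
Qed.

(** Restricted to bounded polyhedral sets, where slice volumes are measurable. [B] is quantified
    inside because an orthogonal map changes the bound on the coordinates. *)
Definition vol_invariant n (O : 'M[R]_n) := forall B (S : set 'rV[R]_n), 0 < B ->
  polyhedral (@affv n) S -> bounded_by B S -> vol [set v | S (v *m O)] = vol S.

Lemma polyhedral_affv_mul n m (M : 'M[R]_(n, m)) S : polyhedral (@affv m) S ->
  polyhedral (@affv n) [set v | S (v *m M)].
Proof. by apply: polyhedral_preimage => l; exact: affv_mul. Qed.

Lemma vol_invariantM n (O P : 'M[R]_n) : P *m P^T = 1%:M ->
  vol_invariant O -> vol_invariant P -> vol_invariant (O *m P).
Proof.
move=> PP iO iP B S B0 dS SB; rewrite -(iP B S)//.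
rewrite -(iO (n%:R * B + 1) [set v | S (v *m P)]).
- by congr vol; apply/seteqP; split=> v /=; rewrite mulmxA.
- by rewrite ltr_wpDl// mulr_ge0// ltW.
- exact: polyhedral_affv_mul.
- by move=> v /= /SB SvP; exact: orth_bound PP SvP.
Qed.

Lemma vol_invariant_diag1 n (Q : 'M[R]_n) : vol_invariant Q -> vol_invariant (diag1 Q).
Proof.
move=> iQ B S B0 dS SB /=; apply: eq_integral => t _.
rewrite -(iQ B [set v | S (cons_rV t v)])//.
- by congr vol; apply/seteqP; split=> v /=; rewrite -mul_cons_diag1.
- by apply: polyhedral_preimage dS => l; exact: affv_cons.
- by move=> v /SB + i => /(_ (lift ord0 i)); rewrite cons_rVS.
Qed.

(** The rotation affects only the two outermost integrals of [vol]. *)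
Lemma vol_invariant_givens n c d : c ^+ 2 + d ^+ 2 = 1 -> vol_invariant (givens n c d).
Proof.
move=> cd B S B0 dS SB /=.
have := integral_rotation cd (vol_measurable2 B0 dS SB) (fun=> vol_ge0 _).
move=> <-; apply: eq_integral => s _; apply: eq_integral => t _; congr vol.
by apply/seteqP; split=> v /=; rewrite -mul_cons_givens.
Qed.

(** Induction on the dimension: [orth_decomp] writes [O] as a plane rotation between two orthogonal
    matrices of smaller size. *)
Lemma orth_vol_invariant n (O : 'M[R]_n) : O *m O^T = 1%:M -> vol_invariant O.
Proof.
elim: n O => [|[|n] IH] O OO.
- move=> B S _ _ _; congr vol; apply/seteqP.
  by split=> v /=; rewrite (thinmx0 (_ *m O)) (thinmx0 v).
(* In dimension 1 the matrix is 1 or -1, and a linear substitution suffices. *)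
- move=> B S B0 dS SB /=; pose o := O ord0 ord0.
  have o1 : `|o| = 1.
    apply/eqP; rewrite -sqr_norm_eq1; apply/eqP.
    by move/matrixP: OO => /(_ ord0 ord0); rewrite !mxE big_ord1 mxE /= -expr2.
  rewrite [RHS](@integral_affine _ o 0%R)//.
  + rewrite o1 mul1e; apply: eq_integral => t _; apply: (congr1 (@vol R 0)).
    have E v : row_mx (\row_(j < 1) t) v *m O = cons_rV (o * t + 0) v.
      rewrite addr0 (thinmx0 v); apply/rowP => i; rewrite !ord1 cons_rV0 mxE big_ord1.
      by rewrite (cons_rV0 t 0) mulrC.
    by apply/seteqP; split=> v /=; rewrite E.
  + by rewrite -normr_eq0 o1 oner_eq0.
  + exact: vol_measurable1 B0 dS SB.
  + by move=> t; exact: (@vol_ge0 0).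
- have [P [Q [c [d [PP QQ cd ->]]]]] := orth_decomp OO.
  apply: vol_invariantM.
  + by rewrite diag1_tr diag1_mul QQ diag1_1.
  + apply: vol_invariantM; first exact: givens_orth.
      exact/vol_invariant_diag1/IH.
    exact: vol_invariant_givens.
  + exact/vol_invariant_diag1/IH.
Qed.

End Invariance.

(** * Polytopes and frames of a hyperplane *)

Section Hull.
Context {R : realType}.

Lemma affine_class_extn X (C A : set (X -> R)) n : affine_class C A ->
  affine_class (lift_class (Y := 'rV[R]_n) C) (extn C A n).
Proof.
move=> CA; split.
- by move=> k; exists (fun=> k) => //; exact: (coef_cst CA).
- by move=> _ _ [a Ca ->] [b Cb ->]; exists (fun x => a x + b x) => //; exact: (coef_add CA).
- by move=> _ _ [a Ca ->] [b Cb ->]; exists (fun x => a x * b x) => //; exact: (coef_mul CA).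
- by move=> _ [a Ca ->]; exists (fun x => (a x)^-1) => //; exact: (coef_inv CA).
- move=> _ [a Ca ->]; exists (fun _ _ => 0), a; split.
  + by move=> _; exact: (coef_cst CA).
  + exact: (aff_coef CA).
  + by apply/funext => p; rewrite big1 ?add0r// => i _; rewrite mul0r.
- move=> _ _ [a [b [Ca Ab ->]]] [a' [b' [Ca' Ab' ->]]].
  exists (fun i x => a i x + a' i x), (fun x => b x + b' x); split.
  + by move=> i; exact: (coef_add CA).
  + exact: (aff_add CA).
  + apply/funext => p; rewrite addrACA; congr (_ + _); rewrite -big_split.
    by apply: eq_bigr => i _; rewrite mulrDl.
- move=> _ _ [c Cc ->] [a [b [Ca Ab ->]]].
  exists (fun i x => c x * a i x), (fun x => c x * b x); split.
  + by move=> i; exact: (coef_mul CA).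
  + exact: (aff_scale CA).
  + apply/funext => p; rewrite mulrDr mulr_sumr; congr (_ + _).
    by apply: eq_bigr => i _; rewrite mulrA.
Qed.

Lemma extn_coord X (C A : set (X -> R)) n i : affine_class C A ->
  extn C A n (fun p => p.2 ord0 i).
Proof.
move=> CA; exists (fun j _ => (j == i)%:R), (fun=> 0); split.
- by move=> j; exact: (coef_cst CA).
- exact: (aff_cst CA).
- apply/funext => p; rewrite addr0 (bigD1 i)//= eqxx mul1r big1 ?addr0// => j ji.
  by rewrite (negbTE ji) mul0r.
Qed.

Lemma extn_base X (C A : set (X -> R)) n l : affine_class C A -> A l ->
  extn C A n (fun p => l p.1).
Proof.
move=> CA Al; exists (fun _ _ => 0), l; split=> //.
- by move=> _; exact: (coef_cst CA).
- by apply/funext => p; rewrite big1 ?add0r// => i _; rewrite mul0r.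
Qed.

Lemma affine_class_affv n :
  affine_class [set c : 'rV[R]_n -> R | exists k, c = fun=> k] (@affv R n).
Proof.
split.
- by move=> k; exists k.
- by move=> _ _ [a ->] [b ->]; exists (a + b).
- by move=> _ _ [a ->] [b ->]; exists (a * b).
- by move=> _ [a ->]; exists a^-1.
- move=> _ [a ->]; exists (fun=> 0), a; apply/funext => v.
  by rewrite big1 ?add0r// => i _; rewrite mul0r.
- move=> _ _ [a [b ->]] [a' [b' ->]]; exists (fun i => a i + a' i), (b + b').
  apply/funext => v; rewrite addrACA; congr (_ + _); rewrite -big_split.
  by apply: eq_bigr => i _; rewrite mulrDl.
- move=> _ _ [c ->] [a [b ->]]; exists (fun i => c * a i), (c * b).
  apply/funext => v; rewrite mulrDr mulr_sumr; congr (_ + _).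
  by apply: eq_bigr => i _; rewrite mulrA.
Qed.

Lemma affv_coord n i : affv (fun v : 'rV[R]_n => v ord0 i).
Proof.
exists (fun j => (j == i)%:R), 0; apply/funext => v.
rewrite addr0 (bigD1 i)//= eqxx mul1r big1 ?addr0// => j ji.
by rewrite (negbTE ji) mul0r.
Qed.

Lemma weight_le1 n (w : 'I_n -> R) i : (forall i, 0 <= w i) -> \sum_(i < n) w i = 1 -> w i <= 1.
Proof.
by move=> w0 <-; rewrite (bigD1 i)//= lerDl; exact: sumr_ge0.
Qed.

(** The hull is the projection of the pairs (point, weights) satisfying the defining linear
    conditions; eliminating the weights leaves a polyhedral set of points. *)
Lemma polyhedral_conv_hull d (V : seq 'rV[R]_d) : polyhedral (@affv R d) (conv_hull V).
Proof.
pose k := size V.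
have CA := affine_class_affv d; have CAn := affine_class_extn k CA.
pose S := [set p : 'rV[R]_d * 'rV[R]_k | forall i, 0 <= p.2 ord0 i] `&`
  ([set p : 'rV[R]_d * 'rV[R]_k | \sum_(i < k) p.2 ord0 i - 1 = 0] `&`
   [set p : 'rV[R]_d * 'rV[R]_k |
     forall j, p.1 ord0 j - \sum_(i < k) V`_i ord0 j * p.2 ord0 i = 0]).
have dS : polyhedral (extn [set c | exists k, c = fun=> k] (@affv R d) k) S.
  apply: polyhedral_setI; last apply: polyhedral_setI.
  - by apply: (polyhedral_forall CAn) => i; apply: polyhedral_ge; exact: extn_coord.
  - apply: (polyhedral_eq0 CAn); apply: (aff_sub CAn); last exact: (aff_cst CAn).
    by apply: (aff_sum CAn) => i; exact: extn_coord.
  - apply: (polyhedral_forall CAn) => j; apply: (polyhedral_eq0 CAn); apply: (aff_sub CAn).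
      exact: (@extn_base _ _ _ k (fun z : 'rV[R]_d => z ord0 j) CA (affv_coord j)).
    apply: (aff_sum CAn) => i; apply: (aff_scale CAn); first exact: (coef_cst CAn).
    exact: extn_coord.
(* Weights lie in [[0, 1]]; 2 gives room for strict bounds. *)
have SB z w : S (z, w) -> forall i, - 2 < w ord0 i < 2.
  move=> [w0 [/eqP+ _]] i; rewrite subr_eq0 => /eqP w1.
  rewrite (@lt_le_trans _ _ 0) ?oppr_lt0//= (@le_lt_trans _ _ 1) ?ltr1n//.
  exact: (@weight_le1 _ (w ord0)).
have B0 : 0 < 2 :> R by [].
have dE := polyhedral_exists_rV B0 CA dS SB.
apply: (polyhedral_eq dE) => z; split=> [[v [v0 [/eqP v1 vz]]]|[w [w0 [w1 ->]]]].
  exists (v ord0); split=> //; split; first by move: v1; rewrite subr_eq0 => /eqP.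
  apply/rowP => j; have /eqP := vz j; rewrite subr_eq0 summxE /= => /eqP ->.
  by apply: eq_bigr => i _; rewrite mxE mulrC.
exists (\row_i w i); split=> [i /=|]; first by rewrite mxE.
split=> [/=|j /=]; first by under eq_bigr do rewrite mxE; rewrite w1 subrr.
apply/eqP; rewrite subr_eq0 summxE; apply/eqP.
by apply: eq_bigr => i _; rewrite !mxE mulrC.
Qed.

Lemma conv_hull_bounded d (V : seq 'rV[R]_d) :
  exists2 B, 0 < B & bounded_by B (conv_hull V).
Proof.
pose B := \sum_(i < size V) \sum_(j < d) `|V`_i ord0 j|.
have B0 : 0 <= B by apply: sumr_ge0 => i _; exact: sumr_ge0.
exists (B + 1); first by rewrite ltr_wpDl.
move=> _ [w [w0 [w1 ->]]] j; rewrite -ltr_norml (@le_lt_trans _ _ B) ?ltrDl//.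
rewrite summxE (le_trans (ler_norm_sum _ _ _))//; apply: ler_sum => i _.
rewrite mxE normrM ger0_norm// (bigD1 j)//= -[leLHS]addr0 lerD ?sumr_ge0//.
by rewrite ler_piMl// weight_le1.
Qed.

End Hull.

(** * Orthonormal frames of a hyperplane *)

Section Frames.
Context {R : realType}.

(** Stacking the unit vector [u] along [x] on top of [M] gives a square orthogonal matrix [W]; then
    [W^T *m W = 1%:M] reads [u^T *m u + M^T *m M = 1%:M]. *)
Lemma frame_projection n (x : 'rV[R]_n.+1) (M : 'M[R]_(n, n.+1)) : x != 0 ->
  M *m M^T = 1%:M -> M *m x^T = 0 ->
  M^T *m M = 1%:M - (dotv x x)^-1 *: (x^T *m x).
Proof.
move=> x0 MM Mx; pose u := (enorm x)^-1 *: x.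
have N0 : dotv x x != 0 by apply: contra_neq x0 => /dotv_eq0.
have e0 : enorm x != 0 by rewrite -sqrf_eq0 enorm_sqr.
have uT : u^T = (enorm x)^-1 *: x^T by apply/matrixP => i j; rewrite !mxE.
have uu : u *m u^T = 1%:M.
  rewrite uT /u -scalemxAl -scalemxAr scalerA dotv_mulmx -enorm_sqr scale_scalar_mx.
  by congr (_%:M); field.
have Mu : M *m u^T = 0 by rewrite uT -scalemxAr Mx scaler0.
have uM : u *m M^T = 0 by rewrite -[LHS]trmxK trmx_mul trmxK Mu trmx0.
have WW : (col_mx u M : 'M[R]_(n.+1)) *m (col_mx u M : 'M[R]_(n.+1))^T = 1%:M.
  rewrite (@tr_col_mx _ 1 n n.+1) (@mul_col_row _ 1 n n.+1 1 n) uu MM Mu uM.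
  by rewrite -(@scalar_mx_block _ 1 n 1).
have := mulmx1C WW; rewrite (@tr_col_mx _ 1 n n.+1) (@mul_row_col _ n.+1 1 n n.+1) => <-.
rewrite uT /u -scalemxAl -scalemxAr scalerA -invfM -expr2 enorm_sqr.
by rewrite addrAC subrr add0r.
Qed.

(** The projection [M^T *m M] fixes the rows of [P], so [P = O *m M] with [O = P *m M^T] orthogonal,
    and [orth_vol_invariant] applies to [O]. *)
Lemma frame_vol n B (K : set 'rV[R]_n.+1) (x : 'rV[R]_n.+1) (M P : 'M[R]_(n, n.+1)) :
  0 < B -> polyhedral (@affv R n.+1) K -> bounded_by B K -> x != 0 ->
  perp_frame x M -> perp_frame x P ->
  vol [set y | K (y *m M)] = vol [set y | K (y *m P)].
Proof.
move=> B0 dK KB x0 [/= MM Mx] [/= PP Px].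
have PE : P = P *m M^T *m M.
  rewrite -mulmxA (frame_projection x0 MM Mx) mulmxBr mulmx1 -scalemxAr mulmxA Px.
  by rewrite mul0mx scaler0 subr0.
have OO : (P *m M^T) *m (P *m M^T)^T = 1%:M.
  by rewrite trmx_mul trmxK mulmxA -PE PP.
rewrite -(orth_vol_invariant OO (B := n.+1%:R * B + 1) (S := [set y | K (y *m M)])).
- by congr vol; apply/seteqP; split=> y /=; rewrite -(mulmxA y) -PE.
- by rewrite ltr_wpDl// mulr_ge0// ltW.
- exact: polyhedral_affv_mul.
- by move=> y /= /KB yB; exact: orth_bound MM yB.
Qed.

Definition householder_frame n (x : 'rV[R]_n.+1) : 'M[R]_(n, n.+1) :=
  \matrix_(i, j) householder x (lift ord0 i) j.

Lemma householder_frame_orth n (x : 'rV[R]_n.+1) :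
  householder_frame x *m (householder_frame x)^T = 1%:M.
Proof.
apply/matrixP => i j; rewrite !mxE.
have /matrixP/(_ (lift ord0 i) (lift ord0 j)) := reflection_orth (x - enorm x *: e0 n).
rewrite !mxE (inj_eq lift_inj) => <-; apply: eq_bigr => k _.
by rewrite !mxE.
Qed.

(** The reflection is symmetric, so it also maps the column [x^T] to a multiple of the first basis
    column; its rows below the first are therefore orthogonal to [x]. *)
Lemma householder_perp_frame n (x : 'rV[R]_n.+1) : perp_frame x (householder_frame x).
Proof.
split; first exact: householder_frame_orth.
have Hx : householder x *m x^T = enorm x *: (e0 n)^T.
  rewrite -[LHS]trmxK trmx_mul trmxK /householder reflection_tr.
  rewrite -/(householder x) householder_mul.
  by apply/matrixP => i j; rewrite !mxE.
apply/matrixP => i j; rewrite !mxE.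
move/matrixP: Hx => /(_ (lift ord0 i) j); rewrite !mxE /= andbF mulr0 => E.
by rewrite -[RHS]E; apply: eq_bigr => k _; rewrite [householder_frame _ _ _]mxE.
Qed.

End Frames.

(** * Semialgebraic functions *)

Section Semialgebraic.
Context {R : realType} {d : nat}.
Local Notation V := 'rV[R]_d.

Definition polyfun : set (V -> R) :=
  [set f | exists p : mpoly.mpoly d R, f = fun x => mpoly.meval (coords x) p].

Lemma polyfun_cst k : polyfun (fun=> k).
Proof.
by exists (mpoly.mpolyC d k); apply/funext => x; rewrite mpoly.mevalC.
Qed.

Lemma polyfun_coord i : polyfun (fun x : V => x ord0 i).
Proof.
by exists (mpoly.mpolyX R (mpoly.mnm1 i)); apply/funext => x; rewrite mpoly.mevalXU.
Qed.

Lemma polyfun_add f g : polyfun f -> polyfun g -> polyfun (fun x => f x + g x).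
Proof.
move=> [p ->] [q ->]; eexists; apply/funext => x.
exact: (esym (mpoly.mevalD (coords x) p q)).
Qed.

Lemma polyfun_mul f g : polyfun f -> polyfun g -> polyfun (fun x => f x * g x).
Proof.
move=> [p ->] [q ->]; eexists; apply/funext => x.
exact: (esym (mpoly.mevalM (coords x) p q)).
Qed.

Lemma polyfun_sub f g : polyfun f -> polyfun g -> polyfun (fun x => f x - g x).
Proof.
move=> pf pg; rewrite (_ : (fun _ => _) = fun x => f x + (- 1) * g x).
  exact/polyfun_add/polyfun_mul/pg/polyfun_cst.
by apply/funext => x; rewrite mulN1r.
Qed.

Lemma polyfun_dotv : polyfun (fun x : V => dotv x x).
Proof.
rewrite /dotv; elim: (index_enum _) => [|i s IH].
  by under eq_fun do rewrite big_nil; exact: polyfun_cst.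
under eq_fun do rewrite big_cons.
by apply: polyfun_add => //; apply: polyfun_mul; exact: polyfun_coord.
Qed.

Lemma semialgebraic_eq (S T : set V) :
  semialgebraic S -> (forall x, S x <-> T x) -> semialgebraic T.
Proof. by move=> dS ST; rewrite (_ : T = S)//; apply/seteqP; split=> x /ST. Qed.

Lemma semialgebraic_polyfun f : polyfun f -> semialgebraic [set x | 0 <= f x].
Proof. by move=> [p ->]; exact: sa_le. Qed.

Lemma semialgebraic_polyfun_eq0 f : polyfun f -> semialgebraic [set x | f x = 0].
Proof.
move=> pf; have pNf := polyfun_sub (polyfun_cst 0) pf.
apply: (semialgebraic_eq (sa_inter (semialgebraic_polyfun pf) (semialgebraic_polyfun pNf))).
move=> x /=; rewrite sub0r oppr_ge0; split=> [[f0 f0']|->//].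
by apply/eqP; rewrite eq_le f0'.
Qed.

(* Since |x|^2 is a polynomial, this class is closed under all field operations. *)
Inductive pwalg : (V -> R) -> Prop :=
| pw_quot p q r : polyfun p -> polyfun q -> polyfun r ->
    pwalg (fun x => (p x + q x * enorm x) / r x)
| pw_if S f g : semialgebraic S -> pwalg f -> pwalg g ->
    pwalg (fun x => if `[< S x >] then f x else g x).

Lemma pwalg_map2 (op : R -> R -> R) :
  (forall p q r p' q' r', polyfun p -> polyfun q -> polyfun r ->
    polyfun p' -> polyfun q' -> polyfun r' ->
    pwalg (fun x => op ((p x + q x * enorm x) / r x) ((p' x + q' x * enorm x) / r' x))) ->
  forall f g, pwalg f -> pwalg g -> pwalg (fun x => op (f x) (g x)).
Proof.
move=> opP f g + pg; elim=> {f} [p q r pp pq pr|S f f' sS _ If _ If'].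
- elim: pg => {g} [p' q' r' pp' pq' pr'|S g g' sS _ Ig _ Ig']; first exact: opP.
  by under eq_fun do rewrite (fun_if (op _)); exact: pw_if.
- by under eq_fun do rewrite (fun_if (op ^~ _)); exact: pw_if.
Qed.

Lemma pwalg_polyfun f : polyfun f -> pwalg f.
Proof.
move=> pf; have := pw_quot pf (polyfun_cst 0) (polyfun_cst 1).
by under eq_fun do rewrite mul0r addr0 divr1.
Qed.

Lemma pwalg_enorm : pwalg (@enorm R d).
Proof.
have := pw_quot (polyfun_cst 0) (polyfun_cst 1) (polyfun_cst 1).
by under eq_fun do rewrite mul1r add0r divr1.
Qed.

Lemma pwalg_eq f g : pwalg f -> f =1 g -> pwalg g.
Proof. by move=> pf /funext <-. Qed.

Lemma pwalg_add f g : pwalg f -> pwalg g -> pwalg (fun x => f x + g x).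
Proof.
apply: pwalg_map2 => p q r p' q' r' pp pq pr pp' pq' pr'.
have pn := polyfun_add (polyfun_mul pp pr') (polyfun_mul pp' pr).
have qn := polyfun_add (polyfun_mul pq pr') (polyfun_mul pq' pr).
(* A quotient with zero denominator has the value 0, so the common denominator is legitimate only
   where [r] and [r'] are both nonzero. *)
apply: (pwalg_eq (pw_if (semialgebraic_polyfun_eq0 pr) (pw_quot pp' pq' pr')
  (pw_if (semialgebraic_polyfun_eq0 pr') (pw_quot pp pq pr)
    (pw_quot pn qn (polyfun_mul pr pr'))))) => x /=.
case: asboolP => [->|/= /eqP r0]; first by rewrite invr0 mulr0 add0r.
case: asboolP => [->|/= /eqP r'0]; first by rewrite invr0 mulr0 addr0.
by field; rewrite r0 r'0.
Qed.

(** No case distinction on denominators: inversion is multiplicative even at 0. The square of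
    [enorm x] is absorbed as the polynomial [dotv x x]. *)
Lemma pwalg_mul f g : pwalg f -> pwalg g -> pwalg (fun x => f x * g x).
Proof.
apply: pwalg_map2 => p q r p' q' r' pp pq pr pp' pq' pr'.
have pn := polyfun_add (polyfun_mul pp pp') (polyfun_mul (polyfun_mul pq pq') polyfun_dotv).
have qn := polyfun_add (polyfun_mul pp pq') (polyfun_mul pq pp').
apply: (pwalg_eq (pw_quot pn qn (polyfun_mul pr pr'))) => x /=.
by rewrite -enorm_sqr [RHS]mulrACA -invfM; congr (_ / _); ring.
Qed.

Lemma enorm_ge0 (x : V) : 0 <= enorm x.
Proof. exact: sqrtr_ge0. Qed.

Lemma pwalg_inv f : pwalg f -> pwalg (fun x => (f x)^-1).
Proof.
elim=> {f} [p q r pp pq pr|S f g sS _ If _ Ig]; last first.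
  by under eq_fun do rewrite (fun_if (fun y => y^-1)); exact: pw_if.
have pD := polyfun_sub (polyfun_mul pp pp) (polyfun_mul (polyfun_mul pq pq) polyfun_dotv).
have pC := polyfun_mul pp pq.
have pNC := polyfun_sub (polyfun_cst 0) pC.
have pz := polyfun_cst 0.
have pNrq := polyfun_sub pz (polyfun_mul pr pq).
(* Multiply by the conjugate p - q|x|, unless the norm p^2 - q^2 |x|^2 vanishes. *)
apply: (pwalg_eq (pw_if (semialgebraic_polyfun_eq0 pD)
  (pw_if (semialgebraic_polyfun pNC) (pwalg_polyfun pz)
     (pw_quot pr pz (polyfun_add pp pp)))
  (pw_quot (polyfun_mul pr pp) pNrq pD))) => x /=.
have s0 := enorm_ge0 x; rewrite -enorm_sqr; move: s0; set s := enorm x => s0.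
rewrite invfM invrK; case: asboolP => [/= D0|/= /eqP D0].
  (* Now [p = q s] or [p = - q s]. If [p q > 0] the first holds and the numerator is [2 p]; if
     [p q <= 0] the numerator vanishes and the inverse is 0 by convention. *)
  have /eqP : (p x - q x * s) * (p x + q x * s) = 0 by rewrite -D0; ring.
  rewrite mulf_eq0 subr_eq0 => /orP[/eqP pqs|/eqP pqs]; case: asboolP => /= C0.
  - have qs0 : q x * s = 0.
      have [q0|q0] := eqVneq (q x) 0; first by rewrite q0 mul0r.
      have : 0 < q x ^+ 2 by rewrite exprn_even_gt0.
      by rewrite pqs in C0; nra.
    by rewrite pqs qs0 addr0 invr0 mul0r.
  - by rewrite -pqs mul0r addr0 mulrC.
  - by rewrite pqs invr0 mul0r.
  - exfalso; apply: C0; move/eqP: pqs; rewrite addr_eq0 => /eqP ->.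
    by rewrite sub0r mulNr opprK mulrAC mulr_ge0// -expr2 sqr_ge0.
have D1 : p x + q x * s != 0.
  apply: contra_neq D0 => E.
  transitivity ((p x - q x * s) * (p x + q x * s)); first by ring.
  by rewrite E mulr0.
by field; rewrite D1.
Qed.

(** The quotient has the sign of [P + Q s] with [P = p r], [Q = q r], [s = enorm x]. When [P] and
    [Q] have opposite signs, comparing the polynomials [P ^+ 2] and [Q ^+ 2 * s ^+ 2] decides the
    sign. *)
Lemma semialgebraic_pwalg f : pwalg f -> semialgebraic [set x | 0 <= f x].
Proof.
elim=> {f} [p q r pp pq pr|S f g sS _ sf _ sg]; last first.
  apply: (semialgebraic_eq (sa_union (sa_inter sS sf) (sa_inter (sa_compl sS) sg))).
  by move=> x /=; case: asboolP => Sx; rewrite /setU/setI/setC/=; tauto.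
have pP := polyfun_mul pp pr; have pQ := polyfun_mul pq pr.
have pP2 := polyfun_mul pP pP; have pQ2 := polyfun_mul (polyfun_mul pQ pQ) polyfun_dotv.
have sP := semialgebraic_polyfun pP; have sQ := semialgebraic_polyfun pQ.
apply: (semialgebraic_eq (sa_union (sa_inter sP sQ) (sa_union
  (sa_inter sP (semialgebraic_polyfun (polyfun_sub pP2 pQ2)))
  (sa_inter sQ (semialgebraic_polyfun (polyfun_sub pQ2 pP2)))))) => x.
rewrite /setU/setI/= !subr_ge0 -enorm_sqr.
have := enorm_ge0 x; move: (enorm x) => s s0.
(* Multiply by [r x ^+ 2]; for [r x = 0] both sides compare 0 with 0. *)
have -> : (0 <= (p x + q x * s) / r x) = (0 <= p x * r x + q x * r x * s).
  have [->|r0] := eqVneq (r x) 0; first by rewrite invr0 !mulr0 mul0r addr0.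
  have r2 : 0 < r x ^+ 2 by rewrite exprn_even_gt0.
  by rewrite -(pmulr_lge0 _ r2); congr (0 <= _); field.
move: (p x * r x) (q x * r x) => P Q.
have -> : Q * Q * s ^+ 2 = (Q * s) * (Q * s) by ring.
split=> [[[P0 Q0]|[[P0 PQ]|[Q0 PQ]]]|PQ].
- by rewrite addr_ge0// mulr_ge0.
- have : - (Q * s) <= P; last by lra.
  rewrite (le_trans (ler_norm _))// normrN -[leRHS]ger0_norm//.
  by rewrite -ler_sqr ?nnegrE// !real_normK ?num_real// !expr2.
- have Qs0 : 0 <= Q * s by rewrite mulr_ge0.
  have : - P <= Q * s; last by lra.
  rewrite (le_trans (ler_norm _))// normrN -[leRHS]ger0_norm//.
  by rewrite -ler_sqr ?nnegrE// !real_normK ?num_real// !expr2.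
- have [P0|P0] := leP 0 P; have [Q0|Q0] := leP 0 Q; first by left.
  + have : Q * s <= 0 by rewrite mulr_le0_ge0// ltW.
    by move=> Qs; right; left; split=> //; nra.
  + by right; right; split=> //; nra.
  + have : Q * s <= 0 by rewrite mulr_le0_ge0// ltW.
    by lra.
Qed.

(** Taking [pwalg] in both roles treats [x] purely as a parameter; the variables to integrate are
    the coordinates within the hyperplane. *)
Lemma affine_class_pwalg : affine_class (pwalg : set (V -> R)) pwalg.
Proof.
split=> //; [|exact: pwalg_add|exact: pwalg_mul|exact: pwalg_inv|exact: pwalg_add|exact: pwalg_mul].
by move=> k; exact/pwalg_polyfun/polyfun_cst.
Qed.

Lemma semialgebraic_polyhedral S : polyhedral pwalg S -> semialgebraic S.
Proof.
elim=> {S} [l|S _|S T _ sS _ sT]; first exact: semialgebraic_pwalg.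
  exact: sa_compl.
exact: sa_inter.
Qed.

Lemma pwalg_pwpoly f : pwpoly pwalg f -> pwalg f.
Proof.
elim=> {f} [//|f g _ pf _ pg|f g _ pf _ pg|S dS].
- exact: pwalg_add.
- exact: pwalg_mul.
- apply: (pwalg_eq (pw_if (semialgebraic_polyhedral dS) (pwalg_polyfun (polyfun_cst 1))
    (pwalg_polyfun (polyfun_cst 0)))) => x.
  by case: asboolP.
Qed.

End Semialgebraic.

(** * The intersection body *)

Section IntersectionBody.
Context {R : realType} {n : nat}.
Local Notation V := 'rV[R]_n.+1.

Lemma pwalg_sub (f g : V -> R) : pwalg f -> pwalg g -> pwalg (fun x => f x - g x).
Proof. exact: (aff_sub affine_class_pwalg). Qed.

Lemma pwalg_householder_frame i j : pwalg (fun x : V => householder_frame x i j).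
Proof.
pose u (x : V) k := x ord0 k - enorm x * (k == ord0)%:R.
have pu k : pwalg (fun x => u x k).
  apply: pwalg_sub; first exact/pwalg_polyfun/polyfun_coord.
  by apply: pwalg_mul; [exact: pwalg_enorm|exact/pwalg_polyfun/polyfun_cst].
have uE (x : V) k : (x - enorm x *: e0 n) ord0 k = u x k by rewrite !mxE.
have pw : pwalg (fun x => (lift ord0 i == j)%:R -
    2 / (\sum_(k < n.+1) u x k * u x k) * (u x (lift ord0 i) * u x j)).
  apply: pwalg_sub; first exact/pwalg_polyfun/polyfun_cst.
  apply: pwalg_mul; last exact: pwalg_mul.
  apply: pwalg_mul; first exact/pwalg_polyfun/polyfun_cst.
  by apply/pwalg_inv/(aff_sum affine_class_pwalg) => k; exact: pwalg_mul.
apply: (pwalg_eq pw) => x.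
rewrite !mxE big_ord1 [(_^T) _ _]mxE !uE; congr (_ - _ / _ * _).
by apply: eq_bigr => k _; rewrite uE.
Qed.

(** In the frame coordinates [y], the affine conditions defining [K] stay affine, with coefficients
    in [pwalg]; so [vol_pwpoly] applies with [x] as parameter. *)
Lemma pwalg_section_vol (K : set V) B : 0 < B -> polyhedral (@affv R n.+1) K -> bounded_by B K ->
  exists2 g, pwalg g &
    forall x, vol [set y | K (y *m householder_frame x)] = (g x)%:E.
Proof.
move=> B0 dK KB; have PW := @affine_class_pwalg R n.+1.
have dS : polyhedral (extn (pwalg : set (V -> R)) pwalg n)
    [set p : V * 'rV[R]_n | K (p.2 *m householder_frame p.1)].
  apply: (polyhedral_preimage (phi := fun p : V * 'rV[R]_n => p.2 *m householder_frame p.1) _ dK).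
  move=> _ [a [b ->]].
  exists (fun i x => \sum_j a j * householder_frame x i j), (fun=> b); split.
  + move=> i; apply: (aff_sum PW) => j; apply: pwalg_mul; last exact: pwalg_householder_frame.
    exact/pwalg_polyfun/polyfun_cst.
  + exact/pwalg_polyfun/polyfun_cst.
  + apply/funext => p; congr (_ + b).
    under eq_bigr do rewrite mxE mulr_sumr.
    rewrite exchange_big; apply: eq_bigr => i _; rewrite mulr_suml.
    by apply: eq_bigr => j _; rewrite -mulrA (mulrC (householder_frame _ _ _)).
(* The bound does not depend on [x], because every frame is orthonormal. *)
have B0' : 0 < n.+1%:R * B + 1 by rewrite ltr_wpDl// mulr_ge0// ltW.
have [|g pg gE] := vol_pwpoly B0' PW dS; last by exists g => //; exact: pwalg_pwpoly.
by move=> x y /= /KB yB; exact: (orth_bound (householder_frame_orth x)) yB.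
Qed.

End IntersectionBody.

Theorem theorem3p2 (R : realType) (d : nat) (V : seq 'rV[R]_d) :
  full_dimensional (conv_hull V) ->
  semialgebraic (intersection_body (conv_hull V)).
Proof.
move=> _; have sZ := semialgebraic_polyfun_eq0 (@polyfun_dotv R d).
have ZE (x : 'rV[R]_d) : dotv x x = 0 <-> x = 0.
  split=> [/dotv_eq0//|->]; rewrite /dotv big1// => i _; rewrite mxE mul0r //.
case: d V sZ ZE => [|n] V sZ ZE.
  (* In dimension 0 the origin is the only point. *)
  by apply: (semialgebraic_eq sZ) => x; rewrite (thinmx0 x); split=> _; [right|exact/ZE].
have [B B0 KB] := conv_hull_bounded V.
have dK := polyhedral_conv_hull V.
have [g pg gE] := pwalg_section_vol B0 dK KB.
have pw1 : pwalg (fun x : 'rV[R]_n.+1 => g x * (enorm x)^-1 - 1).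
  apply: pwalg_sub; last exact/pwalg_polyfun/polyfun_cst.
  by apply: pwalg_mul => //; apply: pwalg_inv; exact: pwalg_enorm.
(* The origin, where the radial function is not defined, is split off as the zero set of
   [dotv x x]. *)
apply: (semialgebraic_eq (sa_union
  (sa_inter (sa_compl sZ) (semialgebraic_pwalg pw1)) sZ)) => x.
have rhoE : x != 0 -> rho_I (conv_hull V) x = (g x * (enorm x)^-1)%:E.
  move=> x0; rewrite /rho_I EFinM -gE; congr (_ * _)%E; rewrite /section_vol.
  (* The frame picked by [xget] may differ from the Householder frame; [frame_vol] equates the two
     section volumes. *)
  apply: (frame_vol B0 dK KB x0 _ (householder_perp_frame x)).
  by apply: (xgetPex 0); exists (householder_frame x); exact: householder_perp_frame.
split=> [[[/= x0 gx]|/ZE ->]|[[x0 gx]|->]].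
- have x0' : x != 0 by apply/eqP => /ZE.
  by left; split=> //; rewrite rhoE// lee_fin -subr_ge0.
- by right.
- left; split=> /=; first by move=> /ZE /eqP; rewrite (negbTE x0).
  by move: gx; rewrite rhoE// lee_fin -subr_ge0.
- by right; exact/ZE.
Qed.
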